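(* Let $D$ generate a one-parameter $C_0$-group $G_D(t)$, $t\in\mathbb{R}$, of isometries in a complex Banach space $\mathbf{E}$, and let $f_0\in\mathbf{B}_\tau(D)$ with $0\le\tau<\sigma$. Then for every $g^*\in\mathbf{E}^*$, $$\langle G_D(z)f_0,g^*\rangle=\sum_{k\in\mathbb{Z}}\left\langle G_D\left(\frac{k\pi}{\sigma}\right)f_0,g^*\right\rangle\mathrm{sinc}\left(\frac{\sigma}{\pi}z-k\right),\quad z\in\mathbb{C},$$ where the series converges uniformly on compact subsets of $\mathbb{C}$.
   Context: A one-parameter $C_0$-group of isometries on a Banach space $\mathbf{E}$ is a map $G_D:\mathbb{R}\to\mathcal{B}(\mathbf{E})$ (bounded operators) with $G_D(t_1+t_2)=G_D(t_1)G_D(t_2)$, $G_D(0)=I$, $\|G_D(t)\|=1$ for all $t\in\mathbb{R}$, and $\lim_{t\to0}\|G_D(t)f-f\|=0$ for all $f\in\mathbf{E}$; $D$ is its generator. For $\tau\ge0$, $\mathbf{B}_\tau(D)$ is the set of all $f\in\bigcap_{k\in\mathbb{N}}\mathcal{D}(D^k)$ with $\|D^kf\|\le\tau^k\|f\|$ for all $k\in\mathbb{N}=\{1,2,\dots\}$. For such $f$ and $z\in\mathbb{C}$, $G_D(z)f:=e^{zD}f=\sum_{k=0}^\infty\frac{z^k}{k!}D^kf$, which extends $t\mapsto G_D(t)f$ from $\mathbb{R}$ to $\mathbb{C}$. $\mathbf{E}^*$ is the dual space and $\langle\cdot,\cdot\rangle$ the duality pairing. The function $\mathrm{sinc}$ is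 $\mathrm{sinc}\,x=\frac{\sin\pi x}{\pi x}$ for $x\ne0$, $\mathrm{sinc}\,0=1$, extended to an entire function on $\mathbb{C}$ by the same formula. The bilateral series over $k\in\mathbb{Z}$ (not absolutely convergent in general) is understood as the limit of the partial sums over $|k|\le N$, $N\to\infty$. *)

(* Defs.v *)
From Stdlib Require Import Reals Factorial Lra Lia List.
From Coquelicot Require Import Coquelicot.
Open Scope R_scope.

(* Meaningful as the operator norm when [T] is bounded; for unbounded [T] the
   supremum is [p_infty], which [real] sends to 0. *)
Definition operator_norm {E : NormedModule C_AbsRing} (T : E -> E) : R :=
  real (Lub_Rbar (fun r => exists f : E, norm f <= 1 /\ r = norm (T f))).

(* [is_linear] is Coquelicot's notion of bounded linear map: it includes the
   existence of a bound [norm (l x) <= M * norm x]. *)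
Record is_isometry_C0_group {E : NormedModule C_AbsRing} (G : R -> E -> E)
  : Prop := {
  group_bounded : forall t : R, is_linear (G t);
  group_add : forall (t1 t2 : R) (f : E), G (t1 + t2) f = G t1 (G t2 f);
  group_zero : forall f : E, G 0 f = f;
  group_norm : forall t : R, operator_norm (G t) = 1;
  group_continuous :
    forall f : E, is_lim (fun t => norm (minus (G t f) f)) 0 0
}.

(* A partially defined operator; [op D f] is meaningless outside [dom D]. *)
Record unbounded_operator (E : Type) := {
  dom : E -> Prop;
  op : E -> E
}.
Arguments dom {E} _ _.
Arguments op {E} _ _.

Definition is_generator {E : NormedModule C_AbsRing}
    (D : unbounded_operator E) (G : R -> E -> E) : Prop :=
  let converges_to f h :=
    filterlim (fun t : R => scal (RtoC (/ t)) (minus (G t f) f))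
      (locally' 0) (locally h) in
  (forall f : E, dom D f <-> exists h : E, converges_to f h) /\
  (forall f : E, dom D f -> converges_to f (op D f)).

Definition op_pow {E : Type} (D : unbounded_operator E) (k : nat) (f : E) : E :=
  Nat.iter k (op D) f.

Fixpoint dom_pow {E : Type} (D : unbounded_operator E) (k : nat) (f : E)
  : Prop :=
  match k with
  | O => True
  | S k' => dom_pow D k' f /\ dom D (op_pow D k' f)
  end.

Definition bernstein {E : NormedModule C_AbsRing} (D : unbounded_operator E)
    (tau : R) (f : E) : Prop :=
  forall k : nat, (1 <= k)%nat ->
    dom_pow D k f /\ norm (op_pow D k f) <= tau ^ k * norm f.

Definition exp_term {E : NormedModule C_AbsRing} (D : unbounded_operator E)
    (z : C) (f : E) (k : nat) : E :=
  scal (z ^ k / RtoC (INR (fact k)))%C (op_pow D k f).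

(* The sum of the exponential series; [iota] picks the (unique) sum, which
   exists on Bernstein spaces by [exp_op_correct] below. *)
Definition exp_op {E : CompleteNormedModule C_AbsRing}
    (D : unbounded_operator E) (z : C) (f : E) : E :=
  iota (fun w : E => is_series (exp_term D z f) w).

Lemma exp_op_correct (E : CompleteNormedModule C_AbsRing)
    (D : unbounded_operator E) (tau : R) (f : E) (z : C) :
  bernstein D tau f -> is_series (exp_term D z f) (exp_op D z f).
Proof.
intros Hf.
assert (Hex : ex_series (exp_term D z f)).
{ apply ex_series_le with
    (b := fun k => norm f * (/ INR (fact k) * (Cmod z * tau) ^ k)).
  - intros k. unfold exp_term.
    eapply Rle_trans; [apply (@norm_scal C_AbsRing E)|].
    change (abs (z ^ k / RtoC (INR (fact k)))%C)
      with (Cmod (z ^ k / RtoC (INR (fact k)))%C).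
    assert (Hk : 0 < INR (fact k)) by apply INR_fact_lt_0.
    rewrite Cmod_div by (intros H; apply RtoC_inj in H; lra).
    rewrite Cmod_R, (Rabs_pos_eq (INR (fact k))) by lra.
    rewrite Cmod_pow, Rpow_mult_distr.
    assert (Hb : norm (op_pow D k f) <= tau ^ k * norm f).
    { destruct k as [|k]; [simpl; lra|]. apply (Hf (S k)); lia. }
    replace (norm f * (/ INR (fact k) * (Cmod z ^ k * tau ^ k)))
      with (Cmod z ^ k / INR (fact k) * (tau ^ k * norm f))
      by (field; lra).
    apply Rmult_le_compat_l; [|exact Hb].
    apply Rmult_le_pos; [apply pow_le, Cmod_ge_0|].
    left; apply Rinv_0_lt_compat; lra.
  - apply (@ex_series_scal R_AbsRing R_NormedModule (norm f)
      (fun k => / INR (fact k) * (Cmod z * tau) ^ k)).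
    exists (exp (Cmod z * tau)).
    apply is_series_ext
      with (fun k => scal (pow_n (Cmod z * tau) k) (/ INR (fact k))).
    + intros k. rewrite pow_n_pow. apply Rmult_comm.
    + apply is_exp_Reals. }
apply (iota_correct (fun w : E => is_series (exp_term D z f) w)).
destruct Hex as [w Hw]. exists w. split; [exact Hw|].
intros w' Hw'.
apply (filterlim_locally_unique (sum_n (exp_term D z f)) w w' Hw Hw').
Qed.

Definition Cexp (z : C) : C :=
  (RtoC (exp (Re z)) * (cos (Im z), sin (Im z)))%C.

Definition Csin (z : C) : C :=
  ((Cexp (Ci * z) - Cexp (- (Ci * z))) / (2 * Ci))%C.

Definition sinc (z : C) : C :=
  if Ceq_dec z 0 then RtoC 1 else (Csin (PI * z) / (PI * z))%C.

Definition symmetric_sum (a : Z -> C) (N : nat) : C :=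
  sum_n (fun j => a (Z.of_nat j - Z.of_nat N)%Z) (2 * N).

Definition is_bilateral_series (a : Z -> C) (l : C) : Prop :=
  filterlim (symmetric_sum a) eventually (locally l).

(* A family of sets is given by its characteristic predicate. *)
Definition compact_set {T : UniformSpace} (K : T -> Prop) : Prop :=
  forall F : (T -> Prop) -> Prop,
    (forall U, F U -> open U) ->
    (forall x, K x -> exists U, F U /\ U x) ->
    exists l : list (T -> Prop),
      (forall U, In U l -> F U) /\
      (forall x, K x -> exists U, In U l /\ U x).

Definition converges_uniformly_on (K : C -> Prop) (u : nat -> C -> C)
    (v : C -> C) : Prop :=
  forall eps : R, 0 < eps -> exists N0 : nat, forall N : nat, (N0 <= N)%nat ->
    forall z : C, K z -> Cmod (u N z - v z)%C < eps.

(* Main.v *)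
(** The telescoping identity behind the proof: with [rho = tau pi / sigma < pi]
and [F v = <G_D(pi v / sigma) f0, g>], an entire function with
[|F^(j) v| <= M rho^j exp (rho |Im v|)], consider
[X s = Sum_(|k| <= N) F (u + s (k - u)) sinc (u - k)]. Then [X 1] is the
partial sampling sum at [u], while [X 0 = F u * Sum sinc (u - k)] tends to
[F u]. Because [(u - k) sinc (u - k) = (-1)^k sin (pi u) / pi],
[X' s] is a multiple of the alternating sum of [F'] along an arithmetic
progression of step [s]; it collapses to two end terms once [F'] is written as
[b (v + s) + b v]. Such a [b] is obtained from the power series of
[1 / (1 + exp w)], whose radius of convergence is [pi > rho]. Integrating the
two end terms by parts against their frequency, of order [N], gives
[X 1 - X 0 = O(1/N)] uniformly for bounded [u]. *)

Require Import Defs.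
From Stdlib Require Import Reals Factorial Lra Lia List Wf_nat.
From Coquelicot Require Import Coquelicot.
Open Scope R_scope.

(** * Finite complex sums and differentiable curves *)

(** Instead of residues or a Paley-Wiener representation, every estimate is a mean value inequality
    along a real parameter: [F] enters only through its Taylor coefficients and one bound for all
    its scaled derivatives on the real axis. The hypothesis tau < sigma is exactly rho < pi. The
    function 1 + exp w vanishes at w = i pi and w = - i pi, so the series for [b] converges for
    every step s rho < pi. This radius is obtained by real means: apart from the constant term, the
    coefficients are dominated by those of tan (x / 2) / 2, which solves y' = y^2 + 1/4 and is
    finite on [0, pi). Two obstacles shape the estimates. First, [b] is an infinite series of
    derivatives that also depends on [s]; it is truncated at an order [J], and [J] goes to infinity
    while [N] stays fixed. Second, X 0 is not yet F u: that the sum of sinc (u - k) is close to 1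
    needs an oscillation argument of its own. There the Dirichlet kernel is singular at 0, and the
    singularity is removed by subtracting the case u = 0, where the sum is exactly 1. *)

Definition Csum (f : nat -> C) (n : nat) : C := sum_n f n.

Arguments Csum : simpl never.

Lemma Csum_S (f : nat -> C) (n : nat) :
  Csum f (S n) = (Csum f n + f (S n))%C.
Proof. exact (sum_Sn f n). Qed.

Lemma Csum_O (f : nat -> C) : Csum f 0 = f 0%nat.
Proof. exact (sum_O f). Qed.

Lemma Csum_shift (f : nat -> C) (n : nat) :
  Csum f (S n) = (f 0%nat + Csum (fun i => f (S i)) n)%C.
Proof.
induction n as [|n IH]; [now rewrite Csum_S, !Csum_O|].
rewrite Csum_S, IH, (Csum_S (fun i => f (S i))). ring.
Qed.

Lemma Csum_ext (f g : nat -> C) (n : nat) :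
  (forall k, (k <= n)%nat -> f k = g k) -> Csum f n = Csum g n.
Proof. intros H. now apply (sum_n_ext_loc (G := C_AbelianMonoid)). Qed.

Lemma Csum_scal (c : C) (f : nat -> C) (n : nat) :
  Csum (fun k => c * f k)%C n = (c * Csum f n)%C.
Proof.
induction n as [|n IH]; [now rewrite !Csum_O|].
rewrite !Csum_S, IH. ring.
Qed.

Lemma Csum_plus (f g : nat -> C) (n : nat) :
  Csum (fun k => f k + g k)%C n = (Csum f n + Csum g n)%C.
Proof.
induction n as [|n IH]; [now rewrite !Csum_O|].
rewrite !Csum_S, IH. ring.
Qed.

Lemma Csum_minus (f g : nat -> C) (n : nat) :
  Csum (fun k => f k - g k)%C n = (Csum f n - Csum g n)%C.
Proof.
induction n as [|n IH]; [now rewrite !Csum_O|].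
rewrite !Csum_S, IH. ring.
Qed.

Lemma Csum_bound (f : nat -> C) (b : nat -> R) (n : nat) :
  (forall k, (k <= n)%nat -> Cmod (f k) <= b k) ->
  Cmod (Csum f n) <= sum_f_R0 b n.
Proof.
intros H. induction n as [|n IH].
- rewrite Csum_O. now apply H.
- rewrite Csum_S. simpl sum_f_R0.
  eapply Rle_trans; [apply Cmod_triangle|].
  apply Rplus_le_compat; [apply IH; intros; apply H; lia|apply H; lia].
Qed.

Lemma Csum_telescope (b : nat -> C) (n : nat) :
  Csum (fun j => b (S j) - b j)%C n = (b (S n) - b 0%nat)%C.
Proof.
induction n as [|n IH]; [now rewrite Csum_O|].
rewrite Csum_S, IH. ring.
Qed.

Lemma Csum_alternating_telescope (b : nat -> C) (n : nat) :
  Csum (fun j => (-1) ^ j * (b (S j) + b j))%C n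
  = ((-1) ^ n * b (S n) + b 0%nat)%C.
Proof.
induction n as [|n IH].
- rewrite Csum_O. simpl. ring.
- rewrite Csum_S, IH, Cpow_S. ring.
Qed.

Lemma Cmod_le_Rabs (z : C) : Cmod z <= Rabs (fst z) + Rabs (snd z).
Proof.
replace z with (RtoC (fst z) + Ci * RtoC (snd z))%C at 1.
- eapply Rle_trans; [apply Cmod_triangle|].
  rewrite Cmod_mult, Cmod_Ci, !Cmod_R. lra.
- destruct z as [x y]. unfold RtoC, Ci, Cplus, Cmult. simpl.
  f_equal; ring.
Qed.

Lemma im_le_Cmod (z : C) : Rabs (snd z) <= Cmod z.
Proof. eapply Rle_trans; [apply Rmax_r|apply Rmax_Cmod]. Qed.

Lemma Cmod_triangle_minus (x y : C) : Cmod (x - y) <= Cmod x + Cmod y.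
Proof.
unfold Cminus. eapply Rle_trans; [apply Cmod_triangle|].
rewrite Cmod_opp. lra.
Qed.

Lemma Cmod_triangle_rev (x y : C) : Cmod x - Cmod y <= Cmod (x - y).
Proof.
assert (H := Cmod_triangle (x - y) y).
replace (x - y + y)%C with x in H by ring. lra.
Qed.

(* Curves are differentiated componentwise, which reduces everything to real
   derivatives. *)
Definition curve_derive (f : R -> C) (x : R) (l : C) : Prop :=
  is_derive (fun t => fst (f t)) x (fst l) /\
  is_derive (fun t => snd (f t)) x (snd l).

Lemma curve_derive_ext (f g : R -> C) (x : R) (l : C) :
  (forall t, f t = g t) -> curve_derive f x l -> curve_derive g x l.
Proof.
intros H [H1 H2]; split;
  [eapply is_derive_ext; [|exact H1]|eapply is_derive_ext; [|exact H2]];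
  intros t; simpl; now rewrite H.
Qed.

Lemma curve_derive_eq (f : R -> C) (x : R) (l l' : C) :
  l = l' -> curve_derive f x l -> curve_derive f x l'.
Proof. now intros ->. Qed.

Lemma curve_derive_const (c : C) (x : R) : curve_derive (fun _ => c) x 0.
Proof. split; apply (is_derive_const (K := R_AbsRing) (V := R_NormedModule)). Qed.

Lemma curve_derive_RtoC (f : R -> R) (x l : R) :
  is_derive f x l -> curve_derive (fun t => RtoC (f t)) x l.
Proof.
intros H; split; simpl; [exact H|].
apply (is_derive_const (K := R_AbsRing) (V := R_NormedModule)).
Qed.

Lemma curve_derive_plus (f g : R -> C) (x : R) (l m : C) :
  curve_derive f x l -> curve_derive g x m ->
  curve_derive (fun t => f t + g t)%C x (l + m)%C.
Proof.
intros [F1 F2] [G1 G2]; split.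
- exact (is_derive_plus _ _ _ _ _ F1 G1).
- exact (is_derive_plus _ _ _ _ _ F2 G2).
Qed.

Lemma curve_derive_mult (f g : R -> C) (x : R) (l m : C) :
  curve_derive f x l -> curve_derive g x m ->
  curve_derive (fun t => f t * g t)%C x (l * g x + f x * m)%C.
Proof.
intros [F1 F2] [G1 G2].
assert (P : forall (p q : R -> R) (a b : R),
  is_derive p x a -> is_derive q x b ->
  is_derive (fun t => p t * q t) x (a * q x + p x * b)).
{ intros p q a b Hp Hq.
  exact (is_derive_mult p q x a b Hp Hq Rmult_comm). }
split; simpl.
- generalize (is_derive_minus _ _ _ _ _ (P _ _ _ _ F1 G1) (P _ _ _ _ F2 G2)).
  unfold minus, plus, opp; simpl. intros H.
  replace (fst l * fst (g x) - snd l * snd (g x) +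
     (fst (f x) * fst m - snd (f x) * snd m)) with
   (fst l * fst (g x) + fst (f x) * fst m +
       - (snd l * snd (g x) + snd (f x) * snd m)) by ring.
  exact H.
- generalize (is_derive_plus _ _ _ _ _ (P _ _ _ _ F1 G2) (P _ _ _ _ F2 G1)).
  unfold plus; simpl. intros H.
  replace (fst l * snd (g x) + snd l * fst (g x) +
   (fst (f x) * snd m + snd (f x) * fst m)) with
   (fst l * snd (g x) + fst (f x) * snd m +
      (snd l * fst (g x) + snd (f x) * fst m)) by ring.
  exact H.
Qed.

Lemma curve_derive_scal (c : C) (f : R -> C) (x : R) (l : C) :
  curve_derive f x l -> curve_derive (fun t => c * f t)%C x (c * l)%C.
Proof.
intros H. eapply curve_derive_eq;
  [|apply (curve_derive_mult _ _ _ _ _ (curve_derive_const c x) H)].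
ring.
Qed.

Lemma curve_derive_minus (f g : R -> C) (x : R) (l m : C) :
  curve_derive f x l -> curve_derive g x m ->
  curve_derive (fun t => f t - g t)%C x (l - m)%C.
Proof.
intros Hf Hg.
apply (curve_derive_ext (fun t => f t + (-(1)) * g t)%C);
  [intros; ring|].
eapply curve_derive_eq;
  [|apply (curve_derive_plus _ _ _ _ _ Hf (curve_derive_scal (-(1)) _ _ _ Hg))].
ring.
Qed.

Lemma curve_derive_sum (f : nat -> R -> C) (n : nat) (x : R) (l : nat -> C) :
  (forall k, (k <= n)%nat -> curve_derive (f k) x (l k)) ->
  curve_derive (fun t => Csum (fun k => f k t) n) x (Csum l n).
Proof.
intros H. induction n as [|n IH].
- rewrite Csum_O. apply (curve_derive_ext (f 0%nat)); [|now apply H].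
  intros t. now rewrite Csum_O.
- rewrite Csum_S.
  apply (curve_derive_ext
    (fun t => Csum (fun k => f k t) n + f (S n) t)%C);
    [intros t; now rewrite Csum_S|].
  apply curve_derive_plus; [apply IH; intros; apply H; lia|apply H; lia].
Qed.

Lemma curve_derive_pow (x : R) (n : nat) :
  curve_derive (fun t => RtoC (t ^ n)) x (RtoC (INR n * x ^ pred n)%R).
Proof.
eapply curve_derive_eq; [|apply curve_derive_RtoC, (is_derive_pow (fun t => t));
  apply (is_derive_id (K := R_AbsRing))].
unfold one; simpl. f_equal. ring.
Qed.

Lemma real_mean_value (f df : R -> R) (a b K : R) :
  a <= b ->
  (forall t, a <= t <= b -> is_derive f t (df t) /\ Rabs (df t) <= K) ->
  Rabs (f b - f a) <= K * (b - a).
Proof.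
intros Hab H.
destruct (MVT_gen f a b df) as [c [Hc E]];
  rewrite ?Rmin_left, ?Rmax_right in * by lra.
- intros x Hx. apply H. lra.
- intros x Hx. apply continuity_pt_filterlim.
  apply (ex_derive_continuous f). exists (df x). now apply H.
- rewrite E, Rabs_mult, (Rabs_pos_eq (b - a)) by lra.
  apply Rmult_le_compat_r; [lra|]. now apply H.
Qed.

(** Real and imaginary parts are bounded separately and added, hence the factor 2, which recurs in
    the constants below. Sharp constants are irrelevant, since only the decay in [N] matters. *)
Lemma curve_mean_value (f df : R -> C) (a b K : R) :
  a <= b ->
  (forall t, a <= t <= b -> curve_derive f t (df t) /\ Cmod (df t) <= K) ->
  Cmod (f b - f a)%C <= 2 * K * (b - a).
Proof.
intros Hab H.
eapply Rle_trans; [apply Cmod_le_Rabs|].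
assert (H1 : Rabs (fst (f b) - fst (f a)) <= K * (b - a)).
{ apply (real_mean_value (fun t => fst (f t)) (fun t => fst (df t)));
    [exact Hab|].
  intros t Ht. destruct (H t Ht) as [[D1 D2] B]. split; [exact D1|].
  eapply Rle_trans; [apply re_le_Cmod|exact B]. }
assert (H2 : Rabs (snd (f b) - snd (f a)) <= K * (b - a)).
{ apply (real_mean_value (fun t => snd (f t)) (fun t => snd (df t)));
    [exact Hab|].
  intros t Ht. destruct (H t Ht) as [[D1 D2] B]. split; [exact D2|].
  eapply Rle_trans; [apply im_le_Cmod|exact B]. }
simpl. unfold Rminus in *. lra.
Qed.

(** * The complex exponential, sine and cosine *)

Lemma Cexp_plus (a b : C) : Cexp (a + b) = (Cexp a * Cexp b)%C.
Proof.
destruct a as [a1 a2], b as [b1 b2]. unfold Cexp. simpl.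
rewrite exp_plus, cos_plus, sin_plus.
unfold Cmult, RtoC; simpl. f_equal; ring.
Qed.

Lemma Cexp_0 : Cexp 0 = RtoC 1.
Proof.
unfold Cexp; simpl. rewrite exp_0, cos_0, sin_0.
unfold Cmult, RtoC; simpl. f_equal; ring.
Qed.

Lemma exp_le_compat (x y : R) : x <= y -> exp x <= exp y.
Proof.
intros [H| ->]; [left; now apply exp_increasing|apply Rle_refl].
Qed.

Lemma Cmod_Cexp (z : C) : Cmod (Cexp z) = exp (Re z).
Proof.
unfold Cexp. rewrite Cmod_mult, Cmod_R, Rabs_pos_eq by (left; apply exp_pos).
unfold Cmod; simpl.
replace (cos (Im z) * (cos (Im z) * 1) + sin (Im z) * (sin (Im z) * 1))
  with 1.
- rewrite sqrt_1. ring.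
- generalize (sin2_cos2 (Im z)). unfold Rsqr. intros. lra.
Qed.

Lemma Cmod_Cexp_le (z : C) : Cmod (Cexp z) <= exp (Cmod z).
Proof.
rewrite Cmod_Cexp. apply exp_le_compat.
eapply Rle_trans; [apply Rle_abs|apply re_le_Cmod].
Qed.

Lemma curve_derive_Cexp (w : C) (x : R) :
  curve_derive (fun t => Cexp (RtoC t * w)) x (w * Cexp (RtoC x * w))%C.
Proof.
destruct w as [a b]. unfold Cexp. split; simpl.
- apply (is_derive_ext (fun t => exp (t * a) * cos (t * b))).
  + intros t. replace (t * a - 0 * b) with (t * a) by ring.
    replace (t * b + 0 * a) with (t * b) by ring. symmetry; simpl. ring.
  + auto_derive; [exact I|].
    replace (x * a - 0 * b) with (x * a) by ring.
    replace (x * b + 0 * a) with (x * b) by ring. ring.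
- apply (is_derive_ext (fun t => exp (t * a) * sin (t * b))).
  + intros t. replace (t * a - 0 * b) with (t * a) by ring.
    replace (t * b + 0 * a) with (t * b) by ring. symmetry; simpl. ring.
  + auto_derive; [exact I|].
    replace (x * a - 0 * b) with (x * a) by ring.
    replace (x * b + 0 * a) with (x * b) by ring. ring.
Qed.

Definition Ccos (z : C) : C := ((Cexp (Ci * z) + Cexp (- (Ci * z))) / 2)%C.

Lemma two_Ci_neq_0 : (2 * Ci)%C <> 0.
Proof.
intros H. injection H. intros. lra.
Qed.

Lemma Ci_neq_0 : Ci <> 0.
Proof. intros H. injection H. lra. Qed.

Lemma Ci_sqr : (Ci * Ci)%C = (- (1))%C.
Proof. unfold Ci, Cmult, Copp, RtoC; simpl; f_equal; ring. Qed.

Lemma C2_neq_0 : RtoC 2 <> 0.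
Proof. intros H. apply RtoC_inj in H. lra. Qed.

Lemma PI_C_neq_0 : RtoC PI <> 0.
Proof. intros H. apply RtoC_inj in H. generalize PI_RGT_0. lra. Qed.

Ltac Cfield :=
  field; repeat split; auto using Ci_neq_0, C2_neq_0, PI_C_neq_0.

Lemma Csin_plus (a b : C) :
  Csin (a + b) = (Csin a * Ccos b + Ccos a * Csin b)%C.
Proof.
unfold Csin, Ccos.
replace (Ci * (a + b))%C with (Ci * a + Ci * b)%C by ring.
replace (- (Ci * a + Ci * b))%C with (- (Ci * a) + - (Ci * b))%C by ring.
rewrite !Cexp_plus. Cfield.
Qed.

Lemma Csin_opp (a : C) : Csin (- a) = (- Csin a)%C.
Proof.
unfold Csin. replace (Ci * - a)%C with (- (Ci * a))%C by ring.
replace (- - (Ci * a))%C with (Ci * a)%C by ring. Cfield.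
Qed.

Lemma Ccos_opp (a : C) : Ccos (- a) = Ccos a.
Proof.
unfold Ccos. replace (Ci * - a)%C with (- (Ci * a))%C by ring.
replace (- - (Ci * a))%C with (Ci * a)%C by ring. Cfield.
Qed.

Lemma Csin_0 : Csin 0 = RtoC 0.
Proof.
unfold Csin. replace (Ci * 0)%C with (RtoC 0) by ring.
replace (- 0)%C with (RtoC 0) by ring. Cfield.
Qed.

Lemma Ccos_0 : Ccos 0 = RtoC 1.
Proof.
unfold Ccos. replace (Ci * 0)%C with (RtoC 0) by ring.
replace (- 0)%C with (RtoC 0) by ring. rewrite Cexp_0. Cfield.
Qed.

Lemma Cexp_Ci_R (x : R) : Cexp (Ci * RtoC x) = (cos x, sin x).
Proof.
unfold Cexp, Ci; simpl.
replace (0 * x - 1 * 0) with 0 by ring.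
replace (0 * 0 + 1 * x) with x by ring.
rewrite exp_0. unfold Cmult, RtoC; simpl. f_equal; ring.
Qed.

Lemma Csin_R (x : R) : Csin (RtoC x) = RtoC (sin x).
Proof.
unfold Csin. replace (- (Ci * x))%C with (Ci * RtoC (- x)%R)%C
  by (rewrite RtoC_opp; ring).
rewrite !Cexp_Ci_R, cos_neg, sin_neg.
replace ((cos x, sin x) - (cos x, (- sin x)%R))%C with (RtoC (sin x) * (2 * Ci))%C.
- Cfield.
- unfold Cminus, Cplus, Copp, Cmult, Ci, RtoC; simpl. f_equal; ring.
Qed.

Lemma Ccos_R (x : R) : Ccos (RtoC x) = RtoC (cos x).
Proof.
unfold Ccos. replace (- (Ci * x))%C with (Ci * RtoC (- x)%R)%C
  by (rewrite RtoC_opp; ring).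
rewrite !Cexp_Ci_R, cos_neg, sin_neg.
replace ((cos x, sin x) + (cos x, (- sin x)%R))%C with (RtoC (cos x) * 2)%C.
- Cfield.
- unfold Cplus, Cmult, RtoC; simpl. f_equal; ring.
Qed.

Lemma Cmod_sin_le (z : C) : Cmod (Csin z) <= exp (Cmod z).
Proof.
unfold Csin. rewrite Cmod_div by apply two_Ci_neq_0.
rewrite Cmod_mult, Cmod_Ci, Cmod_R, Rabs_pos_eq by lra.
assert (H1 := Cmod_Cexp_le (Ci * z)). assert (H2 := Cmod_Cexp_le (- (Ci * z))).
rewrite Cmod_opp, Cmod_mult, Cmod_Ci, Rmult_1_l in H2.
rewrite Cmod_mult, Cmod_Ci, Rmult_1_l in H1.
assert (H3 := Cmod_triangle_minus (Cexp (Ci * z)) (Cexp (- (Ci * z)))).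
lra.
Qed.

Lemma Cmod_cos_le (z : C) : Cmod (Ccos z) <= exp (Cmod z).
Proof.
unfold Ccos. rewrite Cmod_div by apply C2_neq_0.
rewrite Cmod_R, Rabs_pos_eq by lra.
assert (H1 := Cmod_Cexp_le (Ci * z)). assert (H2 := Cmod_Cexp_le (- (Ci * z))).
rewrite Cmod_opp, Cmod_mult, Cmod_Ci, Rmult_1_l in H2.
rewrite Cmod_mult, Cmod_Ci, Rmult_1_l in H1.
assert (H3 := Cmod_triangle (Cexp (Ci * z)) (Cexp (- (Ci * z)))).
lra.
Qed.

Lemma curve_derive_sin (w : C) (x : R) :
  curve_derive (fun t => Csin (RtoC t * w)) x (w * Ccos (RtoC x * w))%C.
Proof.
apply (curve_derive_ext (fun t =>
  / (2 * Ci) * (Cexp (RtoC t * (Ci * w)) - Cexp (RtoC t * (- (Ci * w)))))%C).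
- intros t. unfold Csin.
  replace (Ci * (t * w))%C with (t * (Ci * w))%C by ring.
  replace (- (t * (Ci * w)))%C with (t * (- (Ci * w)))%C by ring.
  Cfield.
- eapply curve_derive_eq; [|apply curve_derive_scal, curve_derive_minus;
    apply curve_derive_Cexp].
  unfold Ccos.
  replace (Ci * (x * w))%C with (x * (Ci * w))%C by ring.
  replace (- (x * (Ci * w)))%C with (x * (- (Ci * w)))%C by ring.
  Cfield.
Qed.

Lemma curve_derive_cos (w : C) (x : R) :
  curve_derive (fun t => Ccos (RtoC t * w)) x (- (w * Csin (RtoC x * w)))%C.
Proof.
apply (curve_derive_ext (fun t =>
  / 2 * (Cexp (RtoC t * (Ci * w)) + Cexp (RtoC t * (- (Ci * w)))))%C).
- intros t. unfold Ccos.
  replace (Ci * (t * w))%C with (t * (Ci * w))%C by ring.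
  replace (- (t * (Ci * w)))%C with (t * (- (Ci * w)))%C by ring.
  Cfield.
- eapply curve_derive_eq; [|apply curve_derive_scal, curve_derive_plus;
    apply curve_derive_Cexp].
  unfold Csin.
  replace (Ci * (x * w))%C with (x * (Ci * w))%C by ring.
  replace (- (x * (Ci * w)))%C with (x * (- (Ci * w)))%C by ring.
  replace (/ 2 * (Ci * w * Cexp (x * (Ci * w)) +
       - (Ci * w) * Cexp (x * - (Ci * w))))%C
    with (/ 2 * ((Ci * Ci) * w * Cexp (x * (Ci * w)) -
       (Ci * Ci) * w * Cexp (x * - (Ci * w))) / Ci)%C
    by Cfield.
  rewrite Ci_sqr. Cfield.
Qed.

Lemma Cmod_sin_small (w : C) (x : R) : 0 <= x ->
  Cmod (Csin (RtoC x * w)) <= 2 * (Cmod w * exp (x * Cmod w)) * x.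
Proof.
intros Hx.
replace (Csin (x * w)) with (Csin (x * w) - Csin (RtoC 0 * w))%C
  by (rewrite Cmult_0_l, Csin_0; ring).
replace (2 * (Cmod w * exp (x * Cmod w)) * x)
  with (2 * (Cmod w * exp (x * Cmod w)) * (x - 0)) by ring.
apply (curve_mean_value (fun t => Csin (RtoC t * w))
  (fun t => w * Ccos (RtoC t * w))%C 0 x); [exact Hx|].
intros t Ht. split; [apply curve_derive_sin|].
rewrite Cmod_mult. apply Rmult_le_compat_l; [apply Cmod_ge_0|].
eapply Rle_trans; [apply Cmod_cos_le|].
rewrite Cmod_mult, Cmod_R, Rabs_pos_eq by lra.
apply exp_le_compat, Rmult_le_compat_r; [apply Cmod_ge_0|lra].
Qed.

Lemma Cmod_cos_small (w : C) (x : R) : 0 <= x ->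
  Cmod (Ccos (RtoC x * w) - 1) <= 4 * (Cmod w ^ 2 * exp (x * Cmod w)) * x ^ 2.
Proof.
intros Hx.
replace (RtoC 1) with (Ccos (RtoC 0 * w)) by (rewrite Cmult_0_l; apply Ccos_0).
replace (4 * (Cmod w ^ 2 * exp (x * Cmod w)) * x ^ 2)
  with (2 * (Cmod w * (2 * (Cmod w * exp (x * Cmod w)) * x)) * (x - 0)) by ring.
apply (curve_mean_value (fun t => Ccos (RtoC t * w))
  (fun t => - (w * Csin (RtoC t * w)))%C 0 x); [exact Hx|].
intros t Ht. split; [apply curve_derive_cos|].
rewrite Cmod_opp, Cmod_mult. apply Rmult_le_compat_l; [apply Cmod_ge_0|].
eapply Rle_trans; [apply Cmod_sin_small; lra|].
assert (Hw := Cmod_ge_0 w).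
apply Rmult_le_compat; try lra.
- repeat apply Rmult_le_pos; try lra. left; apply exp_pos.
- apply Rmult_le_compat_l; [lra|]. apply Rmult_le_compat_l; [lra|].
  apply exp_le_compat, Rmult_le_compat_r; lra.
Qed.

Lemma Csin_shift_pi (z : C) : Csin (z + RtoC PI) = (- Csin z)%C.
Proof.
rewrite Csin_plus, Csin_R, Ccos_R, sin_PI, cos_PI. ring.
Qed.

Definition node (N j : nat) : C := (INR j - INR N)%C.

Lemma node_IZR (N j : nat) :
  RtoC (IZR (Z.of_nat j - Z.of_nat N)) = node N j.
Proof.
unfold node. now rewrite minus_IZR, <- !INR_IZR_INZ, RtoC_minus.
Qed.

Lemma sin_node (u : C) (N j : nat) :
  Csin (PI * (u - node N j)) = ((-1) ^ j * (-1) ^ N * Csin (PI * u))%C.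
Proof.
assert (A : forall v n, Csin (PI * (v + INR n)) = ((-1) ^ n * Csin (PI * v))%C).
{ intros v n. induction n as [|n IH].
  - simpl. rewrite Cplus_0_r. ring.
  - rewrite S_INR, RtoC_plus.
    replace (PI * (v + (INR n + 1)))%C with (PI * (v + INR n) + PI)%C by ring.
    rewrite Csin_shift_pi, IH, Cpow_S. ring. }
assert (S : forall n, ((-1) ^ n * (-1) ^ n = 1)%C).
{ intros n. rewrite <- Cpow_mult_l. replace (-1 * -1)%C with (RtoC 1).
  apply Cpow_1_l. rewrite <- RtoC_mult. f_equal. ring. }
(* Shifting [u - node N j] by [j] and [u] by [N] leads to the same point, so [A] is needed for
   natural shifts only. *)
assert (B := A (u - node N j)%C j).
replace (u - node N j + INR j)%C with (u + INR N)%C in B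
  by (unfold node; ring).
rewrite A in B.
replace (Csin (PI * (u - node N j)))
  with (((-1) ^ j * (-1) ^ j) * Csin (PI * (u - node N j)))%C
  by (rewrite S; ring).
rewrite <- Cmult_assoc, <- B. ring.
Qed.

Lemma mult_sinc (w : C) : (PI * w * sinc w)%C = Csin (PI * w).
Proof.
unfold sinc. destruct (Ceq_dec w 0) as [->|H].
- rewrite !Cmult_0_r, Csin_0. ring.
- Cfield.
Qed.

(* The primitive of [l => Ccos (l w)] that vanishes at [0]; its value at [PI]
   is [PI * sinc w]. *)
Definition cos_primitive (w : C) (l : R) : C :=
  if Ceq_dec w 0 then RtoC l else (Csin (l * w) / w)%C.

Lemma curve_derive_cos_primitive (w : C) (x : R) :
  curve_derive (cos_primitive w) x (Ccos (RtoC x * w)).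
Proof.
unfold cos_primitive. destruct (Ceq_dec w 0) as [->|H].
- rewrite Cmult_0_r, Ccos_0.
  apply (curve_derive_RtoC (fun t => t)).
  apply (is_derive_id (K := R_AbsRing)).
- apply (curve_derive_ext (fun t => / w * Csin (RtoC t * w))%C).
  + intros t. Cfield.
  + eapply curve_derive_eq; [|apply curve_derive_scal, curve_derive_sin].
    Cfield.
Qed.

Lemma cos_primitive_PI (w : C) : cos_primitive w PI = (PI * sinc w)%C.
Proof.
unfold cos_primitive, sinc. destruct (Ceq_dec w 0) as [->|H]; [ring|].
Cfield.
Qed.

Lemma cos_primitive_0 (w : C) : cos_primitive w 0 = RtoC 0.
Proof.
unfold cos_primitive. destruct (Ceq_dec w 0) as [->|H]; [reflexivity|].
rewrite Cmult_0_l, Csin_0. Cfield.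
Qed.

(** * The cardinal series of the constant function 1 *)

Lemma node_S (N j : nat) : node N (S j) = (node N j + 1)%C.
Proof. unfold node. rewrite S_INR, RtoC_plus. ring. Qed.

Lemma node_O (N : nat) : node N 0 = (- INR N)%C.
Proof. unfold node. change (INR 0) with 0. ring. Qed.

Lemma node_last (N : nat) : node N (2 * N) = INR N.
Proof.
unfold node. rewrite mult_INR, RtoC_mult. change (INR 2) with (1 + 1).
rewrite RtoC_plus. ring.
Qed.

Lemma node_eq_0 (N j : nat) : node N j = 0 -> j = N.
Proof.
unfold node. rewrite <- RtoC_minus. intros H. apply RtoC_inj in H.
apply INR_eq. lra.
Qed.

Lemma Cmod_node_le (N j : nat) : (j <= 2 * N)%nat -> Cmod (node N j) <= INR N.
Proof.
intros H. unfold node. rewrite <- RtoC_minus, Cmod_R.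
apply le_INR in H. rewrite mult_INR in H. simpl in H.
assert (H0 := pos_INR j). apply Rabs_le. lra.
Qed.

Lemma Csum_single (c : C) (N n : nat) (f : nat -> C) :
  (N <= n)%nat -> f N = c -> (forall j, j <> N -> f j = 0) -> Csum f n = c.
Proof.
intros HN Hc H0. induction n as [|n IH].
- rewrite Csum_O. replace 0%nat with N by lia. exact Hc.
- rewrite Csum_S. destruct (Nat.eq_dec N (S n)) as [E|E].
  + rewrite <- E, Hc.
    replace (Csum f n) with (RtoC 0); [ring|]. clear IH Hc.
    assert (A : forall m, (m < N)%nat -> Csum f m = RtoC 0).
    { induction m as [|m IHm]; intros Hm.
      - rewrite Csum_O. apply H0. lia.
      - rewrite Csum_S, IHm, H0 by lia. ring. }
    symmetry. apply A. lia.
  + rewrite IH, H0 by lia. ring.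
Qed.

Lemma sinc_sum_at_0 (N : nat) :
  Csum (fun j => sinc (0 - node N j)) (2 * N) = RtoC 1.
Proof.
apply (Csum_single _ N); [lia| |].
- unfold node, sinc. destruct (Ceq_dec _ 0) as [_|H]; [reflexivity|].
  exfalso. apply H. ring.
- intros j Hj.
  assert (H : (0 - node N j)%C <> 0).
  { intros H. apply Hj, (node_eq_0 N). replace (node N j) with (- (0 - node N j))%C
      by ring. rewrite H. ring. }
  unfold sinc. destruct (Ceq_dec _ 0) as [E|_]; [contradiction|].
  rewrite sin_node, Cmult_0_r, Csin_0. unfold Cdiv. ring.
Qed.

(** Multiplied by 2 sin (l / 2), each cosine becomes a difference of sines taken half a step to
    either side of its node, and the sum telescopes. *)
Lemma dirichlet_kernel (u : C) (l : R) (N : nat) :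
  (2 * sin (l / 2) * Csum (fun j => Ccos (l * (u - node N j))) (2 * N)
   = 2 * Ccos (l * u) * sin ((INR N + / 2) * l)%R)%C.
Proof.
set (b := fun j => (- Csin (l * (u - node N j + / 2)))%C).
rewrite <- Csum_scal.
rewrite (Csum_ext _ (fun j => (b (S j) - b j)%C)).
- rewrite Csum_telescope. unfold b.
  rewrite node_O, node_S, node_last.
  rewrite <- !Csin_R.
  replace (l * (u - (INR N + 1) + / 2))%C
    with (l * u + - RtoC ((INR N + / 2) * l)%R)%C
    by (rewrite RtoC_mult, RtoC_plus, RtoC_inv by lra; Cfield).
  replace (l * (u - - INR N + / 2))%C
    with (l * u + RtoC ((INR N + / 2) * l)%R)%C
    by (rewrite RtoC_mult, RtoC_plus, RtoC_inv by lra; Cfield).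
  rewrite !Csin_plus, Csin_opp, Ccos_opp. ring.
- intros j _. unfold b. rewrite node_S, <- Csin_R.
  replace (l * (u - (node N j + 1) + / 2))%C
    with (l * (u - node N j) + - RtoC (l / 2)%R)%C
    by (rewrite RtoC_div by lra; Cfield).
  replace (l * (u - node N j + / 2))%C
    with (l * (u - node N j) + RtoC (l / 2)%R)%C
    by (rewrite RtoC_div by lra; Cfield).
  rewrite !Csin_plus, Csin_opp, Ccos_opp. ring.
Qed.

(** The Taylor minorant of degree 7 leaves ample room for the slope 1/3. The range up to 2 covers l
    / 2 for l <= pi, using only pi <= 4. *)
Lemma sin_lower (x : R) : 0 <= x <= 2 -> x / 3 <= sin x.
Proof.
intros Hx.
assert (H : sin_lb x <= sin x).
{ apply SIN; [lra|]. generalize PI2_3_2. lra. }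
eapply Rle_trans; [|exact H].
unfold sin_lb, sin_approx, sin_term. simpl.
assert (H2 : 0 <= x * x <= 4) by nra.
match goal with |- _ <= ?r =>
  replace r with (x - x * (x * x) / 6 + x * (x * x) * (x * x) / 120
    - x * (x * x) * (x * x) * (x * x) / 5040) by field end.
set (y := x * x) in *.
assert (0 <= x * (1 - y / 6 - / 3)) by (apply Rmult_le_pos; lra).
assert (0 <= x * (y * y * (/ 120 - y / 5040))).
{ apply Rmult_le_pos; [lra|]. apply Rmult_le_pos; [nra|lra]. }
nra.
Qed.

Lemma half_sin_lower (l : R) : 0 <= l <= PI -> l / 3 <= 2 * sin (l / 2).
Proof.
intros H. assert (P := PI_4).
assert (A := sin_lower (l / 2)). lra.
Qed.

Lemma le_of_le_plus_small (x a b p : R) : 0 < p ->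
  (forall eps, 0 < eps <= p -> x <= a + b * eps) -> x <= a.
Proof.
intros Hp H. apply le_epsilon. intros d Hd.
assert (Hb := Rabs_pos b).
set (eps := Rmin p (d / (Rabs b + 1))).
assert (He : 0 < eps).
{ apply Rmin_pos; [exact Hp|]. apply Rdiv_lt_0_compat; lra. }
eapply Rle_trans; [apply (H eps); split; [exact He|apply Rmin_l]|].
assert (H2 : eps <= d / (Rabs b + 1)) by apply Rmin_r.
assert (H3 : eps * (Rabs b + 1) <= d).
{ replace d with (d / (Rabs b + 1) * (Rabs b + 1)) by (field; lra).
  apply Rmult_le_compat_r; lra. }
assert (H4 := Rle_abs b). nra.
Qed.

Section SincSum.
Variables (B : R) (u : C) (N : nat).
Hypothesis HB : Cmod u <= B.

Let nu := INR N + / 2.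
Let e := exp (PI * B).

(** The factor that multiplies the oscillation 2 sin (nu l) in [defect']. The subtracted 1 stems
    from the case u = 0; it makes the numerator O(l^2), which outweighs the simple zero of sin (l /
    2) at the origin. *)
Local Definition quotient (l : R) : C :=
  ((Ccos (l * u) - 1) * RtoC (/ (2 * sin (l / 2))))%C.

Local Definition quotient' (l : R) : C :=
  (- (u * Csin (l * u)) * RtoC (/ (2 * sin (l / 2)))
   + (Ccos (l * u) - 1) * RtoC (- cos (l / 2) / (2 * sin (l / 2)) ^ 2))%C.

Lemma B_pos : 0 <= B.
Proof. eapply Rle_trans; [apply Cmod_ge_0|exact HB]. Qed.

Lemma exp_le_e (l : R) : 0 <= l <= PI -> exp (l * Cmod u) <= e.
Proof.
intros H. apply exp_le_compat. assert (P := Cmod_ge_0 u).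
apply Rmult_le_compat; lra.
Qed.

Lemma Cmod_quotient (l : R) :
  0 < l <= PI -> Cmod (quotient l) <= 12 * (B ^ 2 * e) * l.
Proof.
intros Hl. unfold quotient. rewrite Cmod_mult, Cmod_R.
assert (S := half_sin_lower l ltac:(lra)).
assert (E := exp_le_e l ltac:(lra)).
rewrite Rabs_pos_eq by (left; apply Rinv_0_lt_compat; lra).
assert (H1 := Cmod_cos_small u l ltac:(lra)).
assert (H2 : / (2 * sin (l / 2)) <= 3 / l).
{ replace (3 / l) with (/ (l / 3)) by (field; lra).
  apply Rinv_le_contravar; lra. }
replace (12 * (B ^ 2 * e) * l) with (4 * (B ^ 2 * e) * l ^ 2 * (3 / l))
  by (field; lra).
apply Rmult_le_compat; [apply Cmod_ge_0| | |exact H2].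
- left; apply Rinv_0_lt_compat; lra.
- eapply Rle_trans; [exact H1|].
  apply Rmult_le_compat_r; [apply pow_le; lra|].
  apply Rmult_le_compat_l; [lra|].
  apply Rmult_le_compat; [apply pow_le, Cmod_ge_0|left; apply exp_pos| |exact E].
  apply pow_incr. split; [apply Cmod_ge_0|exact HB].
Qed.

Lemma Cmod_quotient' (l : R) :
  0 < l <= PI -> Cmod (quotient' l) <= 42 * (B ^ 2 * e).
Proof.
intros Hl. unfold quotient'.
assert (S := half_sin_lower l ltac:(lra)).
assert (E := exp_le_e l ltac:(lra)).
assert (Bp := B_pos). assert (up := Cmod_ge_0 u).
assert (ep : 0 < e) by apply exp_pos.
assert (ep' : 0 < exp (l * Cmod u)) by apply exp_pos.
assert (H1 := Cmod_cos_small u l ltac:(lra)).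
assert (H1' := Cmod_sin_small u l ltac:(lra)).
assert (H2 : 0 < / (2 * sin (l / 2)) <= 3 / l).
{ split; [apply Rinv_0_lt_compat; lra|].
  replace (3 / l) with (/ (l / 3)) by (field; lra).
  apply Rinv_le_contravar; lra. }
assert (Q : Cmod u ^ 2 * exp (l * Cmod u) <= B ^ 2 * e).
{ apply Rmult_le_compat; [apply pow_le, up|lra| |exact E].
  apply pow_incr. lra. }
eapply Rle_trans; [apply Cmod_triangle|].
(* 42 = 2 * 3 + 4 * 3^2: the sine and cosine estimates, with the bound 3 / l for the reciprocal used
   once and twice. *)
replace (42 * (B ^ 2 * e)) with
  (2 * (B ^ 2 * e) * l * (3 / l) + 4 * (B ^ 2 * e) * l ^ 2 * (3 / l) ^ 2)
  by (field; lra).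
rewrite !Cmod_mult, !Cmod_R, Cmod_opp, Cmod_mult.
apply Rplus_le_compat.
- rewrite (Rabs_pos_eq (/ _)) by lra.
  apply Rmult_le_compat; try lra.
  { apply Rmult_le_pos; [apply up|apply Cmod_ge_0]. }
  apply Rle_trans with (Cmod u * (2 * (Cmod u * exp (l * Cmod u)) * l)).
  { apply Rmult_le_compat_l; lra. }
  replace (Cmod u * (2 * (Cmod u * exp (l * Cmod u)) * l))
    with (2 * (Cmod u ^ 2 * exp (l * Cmod u)) * l) by ring.
  apply Rmult_le_compat_r; lra.
- apply Rmult_le_compat; [apply Cmod_ge_0|apply Rabs_pos| |].
  + eapply Rle_trans; [exact H1|].
    apply Rmult_le_compat_r; [apply pow_le; lra|]. lra.
  + unfold Rdiv at 1. rewrite Rabs_mult, Rabs_Ropp.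
    rewrite <- pow_inv, (Rabs_pos_eq (_ ^ 2)) by (apply pow_le; lra).
    rewrite <- (Rmult_1_l ((3 / l) ^ 2)).
    apply Rmult_le_compat; [apply Rabs_pos|apply pow_le; lra| |].
    * apply Rabs_le. apply COS_bound.
    * apply pow_incr. lra.
Qed.

Lemma curve_derive_quotient (l : R) :
  0 < l <= PI -> curve_derive quotient l (quotient' l).
Proof.
intros Hl. unfold quotient, quotient'.
assert (S := half_sin_lower l ltac:(lra)).
eapply curve_derive_eq; [|apply curve_derive_mult;
 [apply curve_derive_minus; [apply curve_derive_cos|apply curve_derive_const]
 |apply curve_derive_RtoC]].
2:{ instantiate (1 := - cos (l / 2) / (2 * sin (l / 2)) ^ 2).
  auto_derive; [lra|]. change (l / 2) with (l * / 2) in *.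
  field. lra. }
cbv beta. ring.
Qed.

Local Definition defect (l : R) : C :=
  Csum (fun j => cos_primitive (u - node N j) l
                 - cos_primitive (0 - node N j) l)%C (2 * N).

Local Definition defect' (l : R) : C :=
  Csum (fun j => Ccos (l * (u - node N j)) - Ccos (l * (0 - node N j)))%C
    (2 * N).

Lemma curve_derive_defect (l : R) : curve_derive defect l (defect' l).
Proof.
apply (curve_derive_sum (fun j l => cos_primitive (u - node N j) l
                 - cos_primitive (0 - node N j) l)%C).
intros k _. apply curve_derive_minus; apply curve_derive_cos_primitive.
Qed.

Lemma defect'_quotient (l : R) : 0 < l <= PI ->
  defect' l = (quotient l * (2 * sin (nu * l))%R)%C.
Proof.
intros Hl. assert (S := half_sin_lower l ltac:(lra)).
unfold defect'. rewrite Csum_minus.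
assert (H1 := dirichlet_kernel u l N). assert (H2 := dirichlet_kernel 0 l N).
rewrite Cmult_0_r, Ccos_0 in H2.
fold nu in H1, H2. unfold quotient.
set (x := Csum (fun j => Ccos (l * (u - node N j))) (2 * N)) in *.
set (y := Csum (fun j => Ccos (l * (0 - node N j))) (2 * N)) in *.
assert (Z : RtoC (sin (l / 2)) <> 0).
{ intros Z. apply RtoC_inj in Z. lra. }
replace (x - y)%C with
  ((2 * sin (l / 2) * x - 2 * sin (l / 2) * y) * / RtoC (2 * sin (l / 2)))%C
  by (rewrite RtoC_mult; Cfield).
rewrite H1, H2, RtoC_inv, !RtoC_mult by lra. ring.
Qed.

Lemma defect_PI_bound : Cmod (defect PI) <= 168 * (B ^ 2 * e) * PI / nu.
Proof.
assert (Hnu : 0 < nu) by (unfold nu; generalize (pos_INR N); lra).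
assert (HPI := PI_RGT_0). assert (Bp := B_pos).
assert (ep : 0 < e) by apply exp_pos.
assert (Qp : 0 <= B ^ 2 * e) by (apply Rmult_le_pos; [apply pow_le|]; lra).
(* Integration by parts: the added boundary term replaces 2 sin (nu l) times [quotient] in the
   derivative by 2 cos (nu l) / nu times [quotient'], a gain of 1 / nu. It vanishes at l = PI
   because cos ((N + 1/2) PI) = 0. *)
set (h := fun l => (defect l + quotient l * RtoC (2 * cos (nu * l) / nu))%C).
set (h' := fun l => (quotient' l * RtoC (2 * cos (nu * l) / nu))%C).
assert (Dh : forall l, 0 < l <= PI -> curve_derive h l (h' l)).
{ intros l Hl. unfold h, h'. eapply curve_derive_eq;
   [|apply curve_derive_plus; [apply curve_derive_defect|
     apply curve_derive_mult; [apply curve_derive_quotient, Hl|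
       apply curve_derive_RtoC]]].
  2:{ instantiate (1 := - (2 * sin (nu * l))). auto_derive; [exact I|].
      field. lra. }
  rewrite defect'_quotient by exact Hl. rewrite RtoC_opp. ring. }
assert (Bc : forall l, Rabs (2 * cos (nu * l) / nu) <= 2 / nu).
{ intros l. unfold Rdiv. rewrite Rabs_mult, (Rabs_pos_eq (/ nu))
    by (left; now apply Rinv_0_lt_compat).
  apply Rmult_le_compat_r; [left; now apply Rinv_0_lt_compat|].
  apply Rabs_le. generalize (COS_bound (nu * l)). lra. }
assert (Bh : forall l, 0 < l <= PI -> Cmod (h' l) <= 84 * (B ^ 2 * e) / nu).
{ intros l Hl. unfold h'. rewrite Cmod_mult, Cmod_R.
  replace (84 * (B ^ 2 * e) / nu) with (42 * (B ^ 2 * e) * (2 / nu))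
    by (field; lra).
  apply Rmult_le_compat; [apply Cmod_ge_0|apply Rabs_pos| |apply Bc].
  now apply Cmod_quotient'. }
(* This bound grows with [N], harmlessly: it controls [defect] on [0, eps] only, and eps goes to 0
   with [N] fixed. The cut at eps keeps [h] away from l = 0, where the denominator of [quotient]
   vanishes. *)
set (L := sum_f_R0 (fun _ => 2 * exp (PI * (B + INR N))) (2 * N)).
assert (BL : forall l, 0 <= l <= PI -> Cmod (defect' l) <= L).
{ intros l Hl. apply Csum_bound. intros k Hk.
  assert (HN := Cmod_node_le N k Hk). assert (N0 := pos_INR N).
  eapply Rle_trans; [apply Cmod_triangle_minus|].
  assert (A : forall v, Cmod v <= B ->
    Cmod (Ccos (l * (v - node N k))) <= exp (PI * (B + INR N))).
  { intros v Hv. eapply Rle_trans; [apply Cmod_cos_le|]. apply exp_le_compat.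
    rewrite Cmod_mult, Cmod_R, Rabs_pos_eq by lra.
    apply Rmult_le_compat; [lra|apply Cmod_ge_0|lra|].
    eapply Rle_trans; [apply Cmod_triangle_minus|]. lra. }
  assert (A1 := A u HB). assert (A2 := A 0 ltac:(rewrite Cmod_0; lra)). lra. }
assert (Heps : forall eps, 0 < eps <= PI ->
  Cmod (defect PI) <= 168 * (B ^ 2 * e) * PI / nu
     + (2 * L + 24 * (B ^ 2 * e) / nu) * eps).
{ intros eps He.
  assert (M1 := curve_mean_value h h' eps PI (84 * (B ^ 2 * e) / nu) ltac:(lra)
    ltac:(intros t Ht; split; [apply Dh|apply Bh]; lra)).
  assert (M2 := curve_mean_value defect defect' 0 eps L ltac:(lra)
    ltac:(intros t Ht; split; [apply curve_derive_defect|apply BL; lra])).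
  assert (Z : defect 0 = RtoC 0).
  { unfold defect. rewrite (Csum_ext _ (fun _ => (0 * 0)%C)).
    - rewrite Csum_scal. ring.
    - intros j _. rewrite !cos_primitive_0. ring. }
  rewrite Z in M2. replace (defect eps - 0)%C with (defect eps) in M2 by ring.
  assert (hPI : h PI = defect PI).
  { unfold h. replace (cos (nu * PI)) with 0; [replace (2 * 0 / nu) with 0 by
      (field; lra); ring|].
    symmetry. unfold nu. clear. induction N as [|n IH].
    - simpl. replace ((0 + / 2) * PI) with (PI / 2) by field. apply cos_PI2.
    - rewrite S_INR. replace ((INR n + 1 + / 2) * PI)
        with ((INR n + / 2) * PI + PI) by ring.
      rewrite neg_cos, IH. ring. }
  rewrite hPI in M1.
  assert (M3 : Cmod (quotient eps * RtoC (2 * cos (nu * eps) / nu))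
    <= 24 * (B ^ 2 * e) / nu * eps).
  { rewrite Cmod_mult, Cmod_R.
    replace (24 * (B ^ 2 * e) / nu * eps)
      with (12 * (B ^ 2 * e) * eps * (2 / nu)) by (field; lra).
    apply Rmult_le_compat; [apply Cmod_ge_0|apply Rabs_pos| |apply Bc].
    now apply Cmod_quotient. }
  assert (M4 : Cmod (h eps) <= 2 * L * (eps - 0) + 24 * (B ^ 2 * e) / nu * eps).
  { unfold h. eapply Rle_trans; [apply Cmod_triangle|]. lra. }
  assert (M5 := Cmod_triangle_rev (defect PI) (h eps)).
  assert (M6 : 2 * (84 * (B ^ 2 * e) / nu) * (PI - eps)
    <= 168 * (B ^ 2 * e) * PI / nu).
  { replace (168 * (B ^ 2 * e) * PI / nu)
      with (2 * (84 * (B ^ 2 * e) / nu) * PI) by (field; lra).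
    apply Rmult_le_compat_l; [|lra].
    apply Rmult_le_pos; [lra|]. apply Rdiv_le_0_compat; lra. }
  lra. }
exact (le_of_le_plus_small _ _ _ PI HPI Heps).
Qed.

Lemma sinc_sum_near_1 :
  Cmod (Csum (fun j => sinc (u - node N j)) (2 * N) - 1)
  <= 168 * (B ^ 2 * e) / nu.
Proof.
assert (HPI := PI_RGT_0).
assert (Hnu : 0 < nu) by (unfold nu; generalize (pos_INR N); lra).
assert (H := defect_PI_bound).
replace (defect PI)
  with (PI * (Csum (fun j => sinc (u - node N j)) (2 * N) - 1))%C in H.
- rewrite Cmod_mult, Cmod_R, Rabs_pos_eq in H by lra.
  apply (Rmult_le_reg_l PI); [exact HPI|].
  eapply Rle_trans; [exact H|]. right. field. lra.
(* The 1 is rewritten as the cardinal sum at 0, the term subtracted in [defect]. *)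
- rewrite <- (sinc_sum_at_0 N), <- Csum_minus, <- Csum_scal.
  apply Csum_ext. intros j _.
  rewrite !cos_primitive_PI. ring.
Qed.
End SincSum.

(** * The power series of 1 / (1 + exp x) *)

Lemma sum_n_triangle {G : AbelianMonoid} (h : nat -> nat -> G) (L : nat) :
  sum_n (fun l => sum_n (fun i => h i (l - i)%nat) l) L
  = sum_n (fun i => sum_n (h i) (L - i)) L.
Proof.
induction L as [|L IH].
- now rewrite !sum_O.
- rewrite sum_Sn, IH, !sum_Sn, Nat.sub_diag, sum_O.
  rewrite (sum_n_ext_loc (fun i => sum_n (h i) (S L - i))
    (fun i => plus (sum_n (h i) (L - i)) (h i (S L - i)%nat))).
  + rewrite sum_n_plus. apply plus_assoc.
  + intros i Hi. replace (S L - i)%nat with (S (L - i)) by lia.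
    apply sum_Sn.
Qed.

Lemma Csum_triangle (h : nat -> nat -> C) (L : nat) :
  Csum (fun l => Csum (fun i => h i (l - i)%nat) l) L
  = Csum (fun i => Csum (h i) (L - i)) L.
Proof. exact (sum_n_triangle (G := C_AbelianMonoid) h L). Qed.

Lemma Rsum_triangle (h : nat -> nat -> R) (L : nat) :
  sum_f_R0 (fun l => sum_f_R0 (fun i => h i (l - i)%nat) l) L
  = sum_f_R0 (fun i => sum_f_R0 (h i) (L - i)) L.
Proof.
rewrite <- !sum_n_Reals.
rewrite (sum_n_ext _ (fun l => sum_n (fun i => h i (l - i)%nat) l))
  by (intros; now rewrite sum_n_Reals).
rewrite (sum_n_triangle (G := R_AbelianMonoid) h L).
apply (sum_n_ext (G := R_AbelianMonoid)). intros. now rewrite sum_n_Reals.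
Qed.

Lemma Rsum_pos (a : nat -> R) (n : nat) :
  (forall k, (k <= n)%nat -> 0 <= a k) -> 0 <= sum_f_R0 a n.
Proof.
induction n as [|n IH]; intros H; simpl; [now apply H|].
apply Rplus_le_le_0_compat; [apply IH; intros; apply H; lia|apply H; lia].
Qed.

Lemma Rsum_mono (a : nat -> R) (m n : nat) :
  (forall k, 0 <= a k) -> (m <= n)%nat -> sum_f_R0 a m <= sum_f_R0 a n.
Proof.
intros Ha H. induction H as [|n H IH]; [lra|]. simpl.
generalize (Ha (S n)). lra.
Qed.

(* Power series solution of [y' = y^2 + e], [y 0 = 0], through its Picard
   iterates; the [n]-th iterate has the right coefficients up to order [n]. *)
Fixpoint riccati_iter (e : R) (n k : nat) : R :=
  match n, k with
  | S n', S j =>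
      ((if Nat.eqb j 0 then e else 0)
       + sum_f_R0 (fun i => riccati_iter e n' i * riccati_iter e n' (j - i)) j)
      / INR (S j)
  | _, _ => 0
  end.

Definition riccati (e : R) (k : nat) : R := riccati_iter e k k.

Lemma riccati_iter_stable (e : R) (n m k : nat) :
  (k <= n)%nat -> (k <= m)%nat -> riccati_iter e n k = riccati_iter e m k.
Proof.
revert m k. induction n as [|n IH]; intros m k Hn Hm.
- replace k with 0%nat by lia. now destruct m.
- destruct k as [|j]; [now destruct m|]. destruct m as [|m]; [lia|].
  cbn [riccati_iter]. f_equal. f_equal. apply sum_eq. intros i Hi.
  rewrite (IH m i), (IH m (j - i)%nat) by lia. reflexivity.
Qed.

Lemma riccati_S (e : R) (j : nat) :
  riccati e (S j)
  = ((if Nat.eqb j 0 then e else 0) + PS_mult (riccati e) (riccati e) j)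
    / INR (S j).
Proof.
unfold riccati at 1. cbn [riccati_iter]. f_equal. f_equal.
apply sum_eq. intros i Hi. unfold riccati.
rewrite (riccati_iter_stable e j i i), (riccati_iter_stable e j (j - i) (j - i))
  by lia. reflexivity.
Qed.

Lemma riccati_pos (e : R) (k : nat) : 0 <= e -> 0 <= riccati e k.
Proof.
intros He. induction k as [k IH] using Wf_nat.lt_wf_ind.
destruct k as [|j]; [cbn; lra|]. rewrite riccati_S.
apply Rdiv_le_0_compat; [|apply lt_0_INR; lia].
apply Rplus_le_le_0_compat; [destruct (Nat.eqb j 0); lra|].
apply Rsum_pos. intros i Hi. apply Rmult_le_pos; apply IH; lia.
Qed.

(** Apart from the source term the recursion has positive coefficients only, so absolute values pass
    through it. For e = 1/4 the coefficients of - tanh (x / 2) / 2 are thus dominated by those of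
    tan (x / 2) / 2. *)
Lemma Rabs_riccati_opp (e : R) (k : nat) :
  0 <= e -> Rabs (riccati (- e) k) <= riccati e k.
Proof.
intros He. induction k as [k IH] using Wf_nat.lt_wf_ind.
destruct k as [|j]; [cbn; rewrite Rabs_R0; lra|]. rewrite !riccati_S.
assert (Hj : 0 < INR (S j)) by (apply lt_0_INR; lia).
unfold Rdiv. rewrite Rabs_mult, (Rabs_pos_eq (/ _))
  by (left; now apply Rinv_0_lt_compat).
apply Rmult_le_compat_r; [left; now apply Rinv_0_lt_compat|].
eapply Rle_trans; [apply Rabs_triang|]. apply Rplus_le_compat.
- destruct (Nat.eqb j 0); [rewrite Rabs_Ropp|]; rewrite Rabs_pos_eq; lra.
- eapply Rle_trans; [apply Rsum_abs|]. apply sum_Rle. intros i Hi.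
  rewrite Rabs_mult. apply Rmult_le_compat; try apply Rabs_pos; apply IH; lia.
Qed.

Definition partial_sum (a : nat -> R) (n : nat) (x : R) : R :=
  sum_f_R0 (fun k => a k * x ^ k) n.

Definition partial_sum' (a : nat -> R) (n : nat) (x : R) : R :=
  sum_f_R0 (fun k => a k * (INR k * x ^ pred k)) n.

Lemma is_derive_partial_sum (a : nat -> R) (n : nat) (x : R) :
  is_derive (partial_sum a n) x (partial_sum' a n x).
Proof.
unfold partial_sum, partial_sum'. induction n as [|n IH]; simpl sum_f_R0.
- auto_derive; [exact I|]. simpl. ring.
- apply (is_derive_plus (K := R_AbsRing) (V := R_NormedModule)
    (fun x => sum_f_R0 (fun k => a k * x ^ k) n) (fun x => a (S n) * x ^ S n));
    [exact IH|].
  auto_derive; [exact I|]. simpl pred. ring.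
Qed.

(** Nonnegative coefficients make truncation lossy in one direction only: by the recursion the
    derivative collects the products of terms whose orders add up to less than [n], all of which
    also occur in the square of the partial sum. *)
Lemma partial_sum_riccati_derive (e : R) (n : nat) (x : R) :
  0 <= e -> 0 <= x ->
  partial_sum' (riccati e) n x <= (partial_sum (riccati e) n x) ^ 2 + e.
Proof.
intros He Hx.
assert (P : forall k, 0 <= riccati e k * x ^ k).
{ intros k. apply Rmult_le_pos; [now apply riccati_pos|now apply pow_le]. }
destruct n as [|n].
{ unfold partial_sum', partial_sum. simpl. nra. }
assert (Q : 0 <= partial_sum (riccati e) n x)
  by (apply Rsum_pos; intros; apply P).
apply Rle_trans with (partial_sum (riccati e) n x ^ 2 + e).
2:{ apply Rplus_le_compat_r, pow_incr. split; [exact Q|].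
  apply Rsum_mono; [exact P|lia]. }
unfold partial_sum'. rewrite decomp_sum by lia. cbv beta.
replace (riccati e 0 * (INR 0 * x ^ pred 0)) with 0 by (simpl; ring).
rewrite Rplus_0_l. simpl pred.
rewrite (sum_eq _ (fun l => (if Nat.eqb l 0 then e else 0) * x ^ l +
   sum_f_R0 (fun i => riccati e i * x ^ i * (riccati e (l - i) * x ^ (l - i))) l)).
2:{ intros l Hl. rewrite riccati_S. cbn [pred]. unfold Rdiv.
  match goal with |- (?t + ?s) * / ?d * (_ * _) = _ =>
    replace ((t + s) * / d * (d * x ^ l)) with (t * x ^ l + x ^ l * s)
      by (field; apply not_0_INR; lia) end.
  f_equal. unfold PS_mult. rewrite scal_sum. apply sum_eq. intros i Hi.
  replace (x ^ l) with (x ^ i * x ^ (l - i)) by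
    (rewrite <- pow_add; f_equal; lia). ring. }
rewrite plus_sum, Rplus_comm. apply Rplus_le_compat.
- rewrite (Rsum_triangle
    (fun i m => riccati e i * x ^ i * (riccati e m * x ^ m))).
  simpl pow. rewrite Rmult_1_r. unfold partial_sum at 1.
  rewrite (Rmult_comm (sum_f_R0 _ _)), scal_sum.
  apply sum_Rle. intros i Hi.
  rewrite (sum_eq _ (fun m => riccati e m * x ^ m * (riccati e i * x ^ i)))
    by (intros; ring).
  rewrite <- scal_sum. apply Rmult_le_compat_l; [apply P|].
  apply Rsum_mono; [exact P|lia].
- clear. induction n as [|n IH]; simpl; [lra|]. lra.
Qed.

(** Comparison with the exact solution: by the differential inequality, atan (2 p) grows at rate at
    most 1/2, hence stays below x / 2. The bound does not depend on [n], and it is finite up to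
    pi. *)
Lemma partial_sum_riccati_bound (n : nat) (x : R) : 0 <= x < PI ->
  partial_sum (riccati (/ 4)) n x <= tan (x / 2) / 2.
Proof.
intros Hx.
set (p := partial_sum (riccati (/ 4)) n).
set (p' := partial_sum' (riccati (/ 4)) n).
assert (D : forall t, is_derive (fun t => atan (2 * p t) - t / 2) t
  (2 * p' t / (1 + (2 * p t) ^ 2) - / 2)).
{ intros t. evar_last.
  - apply (is_derive_minus (K := R_AbsRing) (V := R_NormedModule)
      (fun t => atan (2 * p t)) (fun t => t / 2)).
    + apply (is_derive_comp (K := R_AbsRing) (V := R_NormedModule)
        atan (fun t => 2 * p t)); [apply is_derive_atan|].
      apply is_derive_scal, is_derive_partial_sum.
    + instantiate (1 := / 2). auto_derive; [exact I|]. field.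
  - fold p'. unfold minus, plus, opp, scal, mult, Rsqr; simpl.
    unfold mult; simpl. field. nra. }
assert (H : atan (2 * p x) <= x / 2).
{ destruct (MVT_gen (fun t => atan (2 * p t) - t / 2) 0 x
    (fun t => 2 * p' t / (1 + (2 * p t) ^ 2) - / 2)) as [c [Hc E]];
    rewrite ?Rmin_left, ?Rmax_right in * by lra.
  - intros t _. apply D.
  - intros t _. apply continuity_pt_filterlim.
    apply (ex_derive_continuous (fun t => atan (2 * p t) - t / 2)).
    eexists. apply D.
  - assert (P0 : p 0 = 0).
    { unfold p, partial_sum. clear. induction n as [|n IH]; simpl;
        [cbn; ring|]. rewrite IH. ring. }
    rewrite P0, Rmult_0_r, atan_0 in E.
    assert (R := partial_sum_riccati_derive (/ 4) n c ltac:(lra) ltac:(lra)).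
    fold p p' in R.
    assert (N : 2 * p' c / (1 + (2 * p c) ^ 2) <= / 2).
    { apply (Rmult_le_reg_r (1 + (2 * p c) ^ 2)); [nra|].
      unfold Rdiv. rewrite Rmult_assoc, Rinv_l by nra. lra. }
    assert ((2 * p' c / (1 + (2 * p c) ^ 2) - / 2) * (x - 0) <= 0) by nra.
    lra. }
apply Rnot_lt_le. intros Hlt.
assert (A : tan (x / 2) < 2 * p x) by lra.
apply atan_increasing in A. rewrite atan_tan in A by lra. lra.
Qed.

(* [1 / (1 + exp x) = 1/2 + y] where [y' = y^2 - 1/4]. *)
Definition logistic_coef (k : nat) : R :=
  match k with O => / 2 | S _ => riccati (- / 4) k end.

Lemma logistic_abs_le (k : nat) :
  Rabs (logistic_coef k) <= (if Nat.eqb k 0 then / 2 else 0) + riccati (/ 4) k.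
Proof.
destruct k as [|k]; [cbn; rewrite Rabs_pos_eq; lra|].
cbn [logistic_coef Nat.eqb]. generalize (Rabs_riccati_opp (/ 4) (S k)). lra.
Qed.

Lemma logistic_sum_bound (x : R) : 0 <= x < PI ->
  exists A, forall n, sum_f_R0 (fun k => Rabs (logistic_coef k) * x ^ k) n <= A.
Proof.
intros Hx. exists (/ 2 + tan (x / 2) / 2). intros n.
apply Rle_trans with
  (sum_f_R0 (fun k => (if Nat.eqb k 0 then / 2 else 0)
     + riccati (/ 4) k * x ^ k) n).
- apply sum_Rle. intros k _.
  apply Rle_trans with (((if Nat.eqb k 0 then / 2 else 0)
     + riccati (/ 4) k) * x ^ k).
  + apply Rmult_le_compat_r; [apply pow_le; lra|apply logistic_abs_le].
  + destruct k; simpl; lra.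
- rewrite plus_sum. apply Rplus_le_compat; [|now apply partial_sum_riccati_bound].
  clear. induction n as [|n IH]; simpl; lra.
Qed.

(** The differential inequality serves a second time: the derived sum is bounded by the square of
    the tangent bound plus 1/4. *)
Lemma logistic_derive_sum_bound (x : R) : 0 <= x < PI ->
  exists A, forall n,
    sum_f_R0 (fun k => Rabs (logistic_coef k) * (INR k * x ^ pred k)) n <= A.
Proof.
intros Hx. exists ((tan (x / 2) / 2) ^ 2 + / 4). intros n.
apply Rle_trans with (partial_sum' (riccati (/ 4)) n x).
- apply sum_Rle. intros k _.
  destruct k as [|k]; [simpl; lra|].
  apply Rmult_le_compat_r;
    [apply Rmult_le_pos; [apply pos_INR|apply pow_le; lra]|].
  generalize (logistic_abs_le (S k)). simpl Nat.eqb. lra.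
- eapply Rle_trans; [apply partial_sum_riccati_derive; lra|].
  apply Rplus_le_compat_r, pow_incr. split.
  + apply Rsum_pos. intros k _. apply Rmult_le_pos;
      [apply riccati_pos; lra|apply pow_le; lra].
  + now apply partial_sum_riccati_bound.
Qed.

Lemma CV_radius_ge_1 (a : nat -> R) (M : R) :
  (forall n, Rabs (a n) <= M) -> Rbar_le 1 (CV_radius a).
Proof.
intros H. apply (proj1 (CV_radius_bounded a)). exists M. intros n.
rewrite pow1, Rmult_1_r. apply H.
Qed.

Lemma CV_radius_pos (a : nat -> R) (x : R) :
  0 < x -> ex_pseries a x -> Rbar_lt 0 (CV_radius a).
Proof.
intros Hx H. apply Rbar_lt_le_trans with x; [exact Hx|].
apply Rbar_not_lt_le. intros Hlt.
apply (CV_disk_outside a x).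
- now rewrite Rabs_pos_eq by lra.
- apply ex_series_lim_0, ex_pseries_R, H.
Qed.

Lemma is_pseries_constant (a x : R) :
  is_pseries (fun n => if Nat.eqb n 0 then a else 0) x a.
Proof.
apply is_pseries_R. unfold is_series.
apply (filterlim_ext (fun _ => a)); [|apply filterlim_const].
intros n. induction n as [|n IH].
- rewrite sum_O. simpl. ring.
- rewrite sum_Sn, <- IH. unfold plus; simpl. ring.
Qed.

Lemma logistic_coef_bounded : exists M, forall n, Rabs (logistic_coef n) <= M.
Proof.
destruct (logistic_sum_bound 1) as [A HA].
{ generalize PI2_3_2. lra. }
exists A. intros n. eapply Rle_trans; [|apply (HA n)].
assert (P : forall k, 0 <= Rabs (logistic_coef k) * 1 ^ k).
{ intros k. rewrite pow1, Rmult_1_r. apply Rabs_pos. }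
destruct n as [|n]; [simpl; rewrite Rmult_1_r; apply Rle_refl|].
rewrite tech5, pow1, Rmult_1_r.
assert (Q := Rsum_pos (fun k => Rabs (logistic_coef k) * 1 ^ k) n
  (fun k _ => P k)).
lra.
Qed.

(** Bounded coefficients give a radius of convergence of at least 1. A neighbourhood of 0 is enough,
    because the identity serves only to compare coefficients. *)
Lemma logistic_identity_near_0 (x : R) : Rabs x < 1 ->
  PSeries logistic_coef x * (1 + exp x) = 1.
Proof.
destruct logistic_coef_bounded as [M HM].
set (c := logistic_coef). set (d := riccati (- / 4)).
assert (Rc : Rbar_le 1 (CV_radius c)) by (now apply (CV_radius_ge_1 c M)).
assert (Hd : forall n, Rabs (d n) <= M).
{ intros [|n]; [|apply (HM (S n))].
  unfold d. cbn. rewrite Rabs_R0. eapply Rle_trans; [apply Rabs_pos|apply (HM 0%nat)]. }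
assert (Rd : Rbar_le 1 (CV_radius d)) by (now apply (CV_radius_ge_1 d M)).
assert (In : forall a t, Rbar_le 1 (CV_radius a) -> Rabs t < 1 ->
  Rbar_lt (Rabs t) (CV_radius a)).
{ intros a t Ha Ht. apply Rbar_lt_le_trans with 1; [exact Ht|exact Ha]. }
set (y := PSeries c).
assert (Y : forall t, Rabs t < 1 -> y t = / 2 + PSeries d t).
{ intros t Ht. unfold y.
  rewrite (PSeries_decr_1 c) by (apply CV_radius_inside; auto).
  rewrite (PSeries_decr_1 d) by (apply CV_radius_inside; auto).
  replace (PSeries (PS_decr_1 c) t) with (PSeries (PS_decr_1 d) t).
  - unfold c at 1, d at 2. cbn. ring.
  - reflexivity. }
(* With y = 1/2 + d, the equation d' = d^2 - 1/4 becomes y' = y^2 - y. *)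
assert (D : forall t, Rabs t < 1 -> is_derive y t (y t * y t - y t)).
{ intros t Ht.
  assert (Dd := is_derive_PSeries d t (In d t Rd Ht)).
  replace (PSeries (PS_derive d) t) with (y t * y t - y t) in Dd.
  - apply (is_derive_ext_loc (fun t => / 2 + PSeries d t)).
    + apply Rabs_def2 in Ht.
      apply (locally_interval _ t (-1) 1); simpl; try lra.
      intros s Hs1 Hs2. symmetry. apply Y. now apply Rabs_def1.
    + evar_last.
      * apply (is_derive_plus (K := R_AbsRing) (V := R_NormedModule)
          (fun _ => / 2) (PSeries d)); [apply is_derive_const|exact Dd].
      * unfold plus, zero; simpl. ring.
  - rewrite Y by exact Ht.
    rewrite (PSeries_ext (PS_derive d)
      (PS_plus (PS_mult d d) (fun n => if Nat.eqb n 0 then - / 4 else 0))).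
    + symmetry. apply is_pseries_unique.
      replace ((/ 2 + PSeries d t) * (/ 2 + PSeries d t) - (/ 2 + PSeries d t))
        with (plus (PSeries d t * PSeries d t) (- / 4))
        by (unfold plus; simpl; field).
      apply (is_pseries_plus (K := R_AbsRing) (V := R_NormedModule));
        [|apply is_pseries_constant].
      apply is_pseries_mult; auto;
        apply PSeries_correct, CV_radius_inside; auto.
    + intros n. unfold PS_derive, d at 1. rewrite riccati_S. fold d.
      unfold PS_plus, plus; simpl AbelianMonoid.plus. field.
      apply not_0_INR. lia. }
set (Y1 := PSeries (PS_Int c)).
assert (DY : forall t, Rabs t < 1 -> is_derive Y1 t (y t)).
{ intros t Ht. unfold y.
  replace (PSeries c t) with (PSeries (PS_derive (PS_Int c)) t).
  - apply is_derive_PSeries. rewrite CV_radius_Int. auto.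
  - apply PSeries_ext. intros n. unfold PS_derive, PS_Int. simpl pred.
    field. apply not_0_INR. lia. }
assert (y0 : y 0 = / 2) by (unfold y; now rewrite PSeries_0).
fold y in Y. clearbody y Y1. intros Hx.
(* The defect w = y (1 + exp) - 1 satisfies the linear equation w' = y w, and exp (- Y1) with Y1' =
   y is its integrating factor. So Z is constant, and it vanishes at 0. *)
set (Z := fun t => (y t * (1 + exp t) - 1) * exp (- Y1 t)).
assert (DZ : forall t, Rabs t < 1 -> is_derive Z t 0).
{ intros t Ht. unfold Z. assert (D1 := D t Ht). assert (D2 := DY t Ht).
  auto_derive.
  - repeat split; eexists; eassumption.
  - assert (E1 : Derive (fun x : R => y x) t = y t * y t - y t)
      by (apply is_derive_unique; exact D1).
    assert (E2 : Derive (fun x : R => Y1 x) t = y t)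
      by (apply is_derive_unique; exact D2).
    rewrite E1, E2. ring. }
assert (E : Z x = Z 0).
{ assert (V := bounded_variation Z (fun _ => 0) 0 0 x).
  assert (W : Rabs (Z x - Z 0) <= 0 * Rabs (x - 0)).
  { apply V. intros t Ht. rewrite !Rminus_0_r in Ht. split; [|rewrite Rabs_R0; lra].
    apply DZ. lra. }
  rewrite Rmult_0_l in W. assert (Rabs (Z x - Z 0) = 0).
  { apply Rle_antisym; [exact W|apply Rabs_pos]. }
  apply Rabs_eq_0 in H. lra. }
assert (Z0 : Z 0 = 0).
{ unfold Z. rewrite y0, exp_0. field. }
rewrite Z0 in E. unfold Z in E.
apply Rmult_integral in E. destruct E as [E|E]; [lra|].
exfalso. generalize (exp_pos (- Y1 x)). lra.
Qed.

(** Comparison of coefficients in c(x) (1 + exp x) = 1. In this finite form the identity can be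
    applied to differentiation in place of x, which is how [half_inverse] is inverted. *)
Lemma logistic_exp_convolution (n : nat) :
  logistic_coef n
  + sum_f_R0 (fun j => logistic_coef j * / INR (fact (n - j))) n
  = if Nat.eqb n 0 then 1 else 0.
Proof.
set (e := fun n => / INR (fact n)).
destruct logistic_coef_bounded as [M HM].
assert (Rc := CV_radius_ge_1 _ M HM).
assert (Re : Rbar_le 1 (CV_radius e)).
{ apply (CV_radius_ge_1 e 1). intros k. unfold e.
  assert (F : 1 <= INR (fact k)).
  { change 1 with (INR 1). apply le_INR. generalize (lt_O_fact k). lia. }
  rewrite Rabs_pos_eq by (left; apply Rinv_0_lt_compat; lra).
  rewrite <- Rinv_1. apply Rinv_le_contravar; lra. }
assert (In : forall a t, Rbar_le 1 (CV_radius a) -> Rabs t < 1 ->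
  Rbar_lt (Rabs t) (CV_radius a)).
{ intros a t Ha Ht. apply Rbar_lt_le_trans with 1; [exact Ht|exact Ha]. }
assert (S : forall x, Rabs x < 1 ->
  is_pseries (PS_plus logistic_coef (PS_mult logistic_coef e)) x 1).
{ intros x Hx. rewrite <- (logistic_identity_near_0 x Hx).
  rewrite Rmult_plus_distr_l, Rmult_1_r.
  apply (is_pseries_plus (K := R_AbsRing) (V := R_NormedModule)).
  - apply PSeries_correct, CV_radius_inside; auto.
  - apply is_pseries_mult; auto; [|apply is_exp_Reals].
    apply PSeries_correct, CV_radius_inside; auto. }
apply (PSeries_ext_recip (PS_plus logistic_coef (PS_mult logistic_coef e))
  (fun n => if Nat.eqb n 0 then 1 else 0)).
- apply (CV_radius_pos _ (/ 2)); [lra|]. exists 1. apply S.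
  rewrite Rabs_pos_eq; lra.
- apply (CV_radius_pos _ (/ 2)); [lra|]. exists 1. apply is_pseries_constant.
- apply (locally_interval _ 0 (-1) 1); simpl; try lra. intros x Hx1 Hx2.
  transitivity 1; [|symmetry; apply is_pseries_unique, is_pseries_constant].
  apply is_pseries_unique, S. now apply Rabs_def1.
Qed.

(** * Absolutely convergent complex series *)

Definition Cconv (u : nat -> C) (l : C) : Prop :=
  forall eps, 0 < eps -> exists N, forall n, (N <= n)%nat ->
    Cmod (u n - l) < eps.

Lemma Cconv_unique (u : nat -> C) (l m : C) : Cconv u l -> Cconv u m -> l = m.
Proof.
intros Hl Hm.
assert (H : Cmod (l - m) = 0).
{ apply Rle_antisym; [|apply Cmod_ge_0]. apply le_epsilon. intros eps He.
  destruct (Hl (eps / 2) ltac:(lra)) as [N1 H1].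
  destruct (Hm (eps / 2) ltac:(lra)) as [N2 H2].
  specialize (H1 (N1 + N2)%nat ltac:(lia)).
  specialize (H2 (N1 + N2)%nat ltac:(lia)).
  replace (l - m)%C with ((u (N1 + N2)%nat - m) - (u (N1 + N2)%nat - l))%C by ring.
  eapply Rle_trans; [apply Cmod_triangle_minus|]. lra. }
apply Cmod_eq_0 in H. replace l with (l - m + m)%C by ring. rewrite H. ring.
Qed.

Lemma Cconv_ext (u v : nat -> C) (l : C) :
  (forall n, u n = v n) -> Cconv u l -> Cconv v l.
Proof.
intros E H eps He. destruct (H eps He) as [N HN].
exists N. intros n Hn. rewrite <- E. now apply HN.
Qed.

Lemma Cconv_plus (u v : nat -> C) (l m : C) :
  Cconv u l -> Cconv v m -> Cconv (fun n => u n + v n)%C (l + m)%C.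
Proof.
intros Hl Hm eps He.
destruct (Hl (eps / 2) ltac:(lra)) as [N1 H1].
destruct (Hm (eps / 2) ltac:(lra)) as [N2 H2].
exists (N1 + N2)%nat. intros n Hn.
specialize (H1 n ltac:(lia)). specialize (H2 n ltac:(lia)).
replace (u n + v n - (l + m))%C with ((u n - l) + (v n - m))%C by ring.
eapply Rle_lt_trans; [apply Cmod_triangle|]. lra.
Qed.

Lemma Cconv_close (u v : nat -> C) (r : nat -> R) (l : C) :
  Cconv u l -> (forall n, Cmod (v n - u n) <= r n) -> is_lim_seq r 0 ->
  Cconv v l.
Proof.
intros Hu Hr Hlim eps He.
destruct (Hu (eps / 2) ltac:(lra)) as [N1 H1].
apply is_lim_seq_spec in Hlim.
destruct (Hlim (mkposreal (eps / 2) ltac:(lra))) as [N2 H2].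
exists (N1 + N2)%nat. intros n Hn.
specialize (H1 n ltac:(lia)). specialize (H2 n ltac:(lia)). simpl in H2.
rewrite Rminus_0_r in H2. apply Rabs_def2 in H2. specialize (Hr n).
replace (v n - l)%C with ((v n - u n) + (u n - l))%C by ring.
eapply Rle_lt_trans; [apply Cmod_triangle|]. lra.
Qed.

(** [Series] has a value even for divergent series, so convergence and size statements about
    [Cseries] come with a dominating real series. *)
Definition Cseries (a : nat -> C) : C :=
  (Series (fun n => fst (a n)), Series (fun n => snd (a n))).

Lemma Cseries_ext (a b : nat -> C) :
  (forall n, a n = b n) -> Cseries a = Cseries b.
Proof.
intros H. unfold Cseries. f_equal; apply Series_ext; intros; now rewrite H.
Qed.

Lemma fst_Csum (a : nat -> C) (n : nat) :
  fst (Csum a n) = sum_f_R0 (fun k => fst (a k)) n.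
Proof.
induction n as [|n IH]; [now rewrite Csum_O|].
rewrite Csum_S, tech5, <- IH. reflexivity.
Qed.

Lemma snd_Csum (a : nat -> C) (n : nat) :
  snd (Csum a n) = sum_f_R0 (fun k => snd (a k)) n.
Proof.
induction n as [|n IH]; [now rewrite Csum_O|].
rewrite Csum_S, tech5, <- IH. reflexivity.
Qed.

Lemma is_series_partial_sums (b : nat -> R) (s : R) :
  is_series b s <-> is_lim_seq (fun n => sum_f_R0 b n) s.
Proof.
unfold is_series. change (filterlim (sum_n b) eventually (locally s))
  with (is_lim_seq (sum_n b) s).
split; apply is_lim_seq_ext; intros; rewrite sum_n_Reals; reflexivity.
Qed.

Section Dominated.
Variables (a : nat -> C) (b : nat -> R) (s : R).
Hypothesis dom : forall n, Cmod (a n) <= b n.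
Hypothesis sumb : is_series b s.

Lemma Cseries_correct : Cconv (Csum a) (Cseries a).
Proof.
assert (H : forall p : nat -> R, (forall n, Rabs (p n) <= b n) ->
  is_lim_seq (fun n => sum_f_R0 p n) (Series p)).
{ intros p Hp. apply is_series_partial_sums, Series_correct.
  apply (ex_series_le (K := R_AbsRing) (V := R_CompleteNormedModule) p b Hp).
  now exists s. }
assert (H1 := H (fun n => fst (a n))
  (fun n => Rle_trans _ _ _ (re_le_Cmod (a n)) (dom n))).
assert (H2 := H (fun n => snd (a n))
  (fun n => Rle_trans _ _ _ (im_le_Cmod (a n)) (dom n))).
intros eps He.
apply is_lim_seq_spec in H1. apply is_lim_seq_spec in H2.
assert (He2 : 0 < eps / 2) by lra.
destruct (H1 (mkposreal _ He2)) as [N1 K1].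
destruct (H2 (mkposreal _ He2)) as [N2 K2].
exists (N1 + N2)%nat. intros n Hn.
specialize (K1 n ltac:(lia)). specialize (K2 n ltac:(lia)). simpl in K1, K2.
eapply Rle_lt_trans; [apply Cmod_le_Rabs|].
unfold Cseries. cbn [fst snd Cminus Cplus Copp].
rewrite fst_Csum, snd_Csum. unfold Rminus in *. lra.
Qed.

Lemma partial_sums_le (n : nat) : sum_f_R0 b n <= s.
Proof.
apply is_series_partial_sums in sumb.
assert (Hb : forall k, 0 <= b k)
  by (intros k; eapply Rle_trans; [apply Cmod_ge_0|apply dom]).
apply (is_lim_seq_le_loc (fun _ => sum_f_R0 b n) (fun m => sum_f_R0 b m)
  (sum_f_R0 b n) s); [|apply is_lim_seq_const|exact sumb].
exists n. intros m Hm. now apply Rsum_mono.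
Qed.

Lemma Cseries_tail (n : nat) :
  Cmod (Cseries a - Csum a n) <= s - sum_f_R0 b n.
Proof.
apply le_epsilon. intros eps He.
destruct (Cseries_correct eps He) as [N HN].
specialize (HN (N + n)%nat ltac:(lia)).
assert (H : forall d, Cmod (Csum a (d + n) - Csum a n)
  <= sum_f_R0 b (d + n) - sum_f_R0 b n).
{ induction d as [|d IH].
  - simpl. unfold Cminus. rewrite Cplus_opp_r, Cmod_0. lra.
  - change (S d + n)%nat with (S (d + n)). rewrite Csum_S. simpl sum_f_R0.
    replace (Csum a (d + n) + a (S (d + n)) - Csum a n)%C
      with ((Csum a (d + n) - Csum a n) + a (S (d + n)))%C by ring.
    eapply Rle_trans; [apply Cmod_triangle|].
    generalize (dom (S (d + n))). lra. }
specialize (H N). assert (P := partial_sums_le (N + n)).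
replace (Cseries a - Csum a n)%C with
  ((Csum a (N + n) - Csum a n) - (Csum a (N + n) - Cseries a))%C by ring.
eapply Rle_trans; [apply Cmod_triangle_minus|]. lra.
Qed.

Lemma Cmod_Cseries_le : Cmod (Cseries a) <= s.
Proof.
assert (H := Cseries_tail 0). rewrite Csum_O in H. simpl in H.
assert (T := Cmod_triangle_rev (Cseries a) (a 0%nat)).
generalize (dom 0). lra.
Qed.

End Dominated.

Lemma Cseries_scal (c : C) (a : nat -> C) (b : nat -> R) (s : R) :
  (forall n, Cmod (a n) <= b n) -> is_series b s ->
  Cseries (fun n => c * a n)%C = (c * Cseries a)%C.
Proof.
intros Hd Hs.
assert (Hc : is_series (fun n => Cmod c * b n) (Cmod c * s))
  by exact (is_series_scal_l (Cmod c) b s Hs).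
apply (Cconv_unique (Csum (fun n => c * a n)%C)).
- apply (Cseries_correct _ _ _) with (2 := Hc). intros n. rewrite Cmod_mult.
  apply Rmult_le_compat_l; [apply Cmod_ge_0|apply Hd].
- intros eps He. assert (Hp := Cmod_ge_0 c).
  destruct (Cseries_correct a b s Hd Hs (eps / (Cmod c + 1))) as [N HN].
  { apply Rdiv_lt_0_compat; lra. }
  exists N. intros n Hn. specialize (HN n Hn).
  rewrite Csum_scal. replace (c * Csum a n - c * Cseries a)%C
    with (c * (Csum a n - Cseries a))%C by ring.
  rewrite Cmod_mult.
  apply Rle_lt_trans with ((Cmod c) * (eps / (Cmod c + 1))).
  + apply Rmult_le_compat_l; lra.
  + apply (Rmult_lt_reg_r (Cmod c + 1)); [lra|].
    replace (Cmod c * (eps / (Cmod c + 1)) * (Cmod c + 1)) with (Cmod c * eps)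
      by (field; lra). nra.
Qed.

(* Rearrangement of an absolutely convergent double series: the discrepancy
   between triangular and iterated partial sums is dominated by the one of the
   real Cauchy product. *)
Lemma Cseries_convolution (al ga a : nat -> C) (M sal sga : R) :
  is_series (fun n => Cmod (al n)) sal ->
  is_series (fun n => Cmod (ga n)) sga ->
  (forall n, Cmod (a n) <= M) ->
  Cconv (Csum (fun l => Csum (fun i => al i * ga (l - i)%nat) l * a l)%C)
    (Cseries (fun n => al n * Cseries (fun m => ga m * a (n + m)%nat))%C).
Proof.
intros Hal Hga Ha.
assert (HM : 0 <= M) by (eapply Rle_trans; [apply Cmod_ge_0|apply (Ha 0%nat)]).
assert (sM : is_series (fun m => Cmod (ga m) * M) (sga * M))
  by exact (is_series_scal_r M _ _ Hga).
assert (dI : forall n m, Cmod (ga m * a (n + m)%nat) <= Cmod (ga m) * M).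
{ intros n m. rewrite Cmod_mult.
  apply Rmult_le_compat_l; [apply Cmod_ge_0|apply Ha]. }
set (I := fun n => Cseries (fun m => ga m * a (n + m)%nat)%C).
assert (bI : forall n, Cmod (I n) <= sga * M)
  by (intros n; exact (Cmod_Cseries_le _ _ _ (dI n) sM)).
apply (Cconv_close (Csum (fun n => al n * I n)%C) _
  (fun L => sum_f_R0 (fun n => Cmod (al n)) L * (sga * M)
    - sum_f_R0 (fun l => sum_f_R0 (fun i => Cmod (al i) * Cmod (ga (l - i)%nat)) l) L
      * M)).
- apply (Cseries_correct _ (fun n => Cmod (al n) * (sga * M)) (sal * (sga * M))).
  + intros n. rewrite Cmod_mult.
    apply Rmult_le_compat_l; [apply Cmod_ge_0|apply bI].
  + exact (is_series_scal_r (sga * M) _ _ Hal).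
- intros L.
  rewrite (Csum_ext _ (fun l => Csum (fun i => al i * ga (l - i)%nat
      * a (i + (l - i))%nat)%C l)).
  2:{ intros l _. rewrite Cmult_comm, <- Csum_scal. apply Csum_ext.
    intros i Hi. replace (i + (l - i))%nat with l by lia. ring. }
  rewrite (Csum_triangle (fun i m => al i * ga m * a (i + m)%nat)%C).
  rewrite <- Csum_minus.
  rewrite (Rsum_triangle (fun i m => Cmod (al i) * Cmod (ga m))).
  match goal with |- _ <= ?x * ?y - ?z * M =>
    replace (x * y - z * M) with (y * x - M * z) by ring end.
  rewrite !scal_sum, <- minus_sum.
  apply Csum_bound. intros i Hi.
  rewrite (Csum_ext _ (fun m => al i * (ga m * a (i + m)%nat))%C)
    by (intros; ring).
  rewrite Csum_scal.
  match goal with |- Cmod (?x * ?y - ?x * ?z) <= _ =>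
    replace (x * y - x * z)%C with (- (x * (z - y)))%C by ring end.
  rewrite Cmod_opp, Cmod_mult.
  rewrite (sum_eq (fun m => Cmod (al i) * Cmod (ga m))
    (fun m => Cmod (ga m) * Cmod (al i))) by (intros; ring).
  rewrite <- scal_sum.
  replace (Cmod (al i) * (sga * M) -
    Cmod (al i) * sum_f_R0 (fun m => Cmod (ga m)) (L - i) * M)
    with (Cmod (al i) * (sga * M - M * sum_f_R0 (fun m => Cmod (ga m)) (L - i)))
    by ring.
  apply Rmult_le_compat_l; [apply Cmod_ge_0|].
  rewrite scal_sum. exact (Cseries_tail _ _ _ (dI i) sM (L - i)).
- assert (P := is_series_mult_pos _ _ _ _ Hal Hga
    (fun n => Cmod_ge_0 (al n)) (fun n => Cmod_ge_0 (ga n))).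
  apply is_series_partial_sums in P. apply is_series_partial_sums in Hal.
  replace 0 with (sal * (sga * M) - sal * sga * M) by ring.
  apply is_lim_seq_minus'; apply is_lim_seq_mult'; try apply is_lim_seq_const;
    assumption.
Qed.

Definition exp_coef (w : C) (n : nat) : C := (w ^ n / INR (fact n))%C.

Lemma fact_C_neq_0 (n : nat) : RtoC (INR (fact n)) <> 0.
Proof. intros H. apply RtoC_inj in H. revert H. apply INR_fact_neq_0. Qed.

Lemma Cmod_exp_coef (w : C) (n : nat) :
  Cmod (exp_coef w n) = Cmod w ^ n / INR (fact n).
Proof.
unfold exp_coef. rewrite Cmod_div by apply fact_C_neq_0.
rewrite Cmod_pow, Cmod_R, Rabs_pos_eq; [reflexivity|apply pos_INR].
Qed.

Lemma is_series_exp (x : R) :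
  is_series (fun n => x ^ n / INR (fact n)) (exp x).
Proof.
assert (H := is_exp_Reals x). apply is_pseries_R in H.
revert H. apply is_series_ext. intros n. unfold Rdiv. apply Rmult_comm.
Qed.

Lemma is_series_exp_coef (w : C) :
  is_series (fun n => Cmod (exp_coef w n)) (exp (Cmod w)).
Proof.
apply (is_series_ext (fun n => Cmod w ^ n / INR (fact n)));
  [intros n; now rewrite Cmod_exp_coef|apply is_series_exp].
Qed.

Lemma exp_coef_O (w : C) : exp_coef w 0 = 1.
Proof. unfold exp_coef. simpl. Cfield. Qed.

Lemma exp_coef_S (w : C) (n : nat) :
  (INR (S n) * exp_coef w (S n))%C = (w * exp_coef w n)%C.
Proof.
unfold exp_coef. rewrite Cpow_S, fact_simpl, mult_INR, RtoC_mult.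
field. split; [apply fact_C_neq_0|].
intros H. apply RtoC_inj in H. revert H. apply not_0_INR. lia.
Qed.

(** The binomial theorem in divided form. Splitting the factor l + 1 as i + (l + 1 - i) lowers one
    of the two indices by [exp_coef_S], a Leibniz rule that reduces the sum of order l + 1 to k + v
    times the one of order l. *)
Lemma exp_coef_plus (k v : C) (l : nat) :
  Csum (fun i => exp_coef k i * exp_coef v (l - i)%nat)%C l
  = exp_coef (k + v) l.
Proof.
induction l as [|l IH].
- rewrite Csum_O. simpl. rewrite !exp_coef_O. ring.
- assert (Hl : RtoC (INR (S l)) <> 0).
  { intros H. apply RtoC_inj in H. revert H. apply not_0_INR. lia. }
  set (T := Csum (fun i => exp_coef k i * exp_coef v (S l - i)%nat)%C (S l)).
  assert (H : (INR (S l) * T)%C = (INR (S l) * exp_coef (k + v) (S l))%C).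
  { rewrite exp_coef_S, <- IH. unfold T.
    rewrite <- Csum_scal.
    rewrite (Csum_ext _ (fun i => INR i * exp_coef k i * exp_coef v (S l - i)%nat
      + exp_coef k i * (INR (S l - i) * exp_coef v (S l - i)%nat))%C).
    2:{ intros i Hi. rewrite minus_INR, RtoC_minus by lia. ring. }
    rewrite Csum_plus, Cmult_plus_distr_r. f_equal.
    - rewrite <- Csum_scal.
      rewrite Csum_shift. simpl INR at 1. rewrite !Cmult_0_l, Cplus_0_l.
      apply Csum_ext. intros i Hi.
      rewrite exp_coef_S. simpl Nat.sub. ring.
    - rewrite Csum_S, Nat.sub_diag. simpl INR at 2.
      rewrite Cmult_0_l, Cmult_0_r, Cplus_0_r, <- Csum_scal.
      apply Csum_ext. intros i Hi.
      replace (S l - i)%nat with (S (l - i)) by lia.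
      rewrite exp_coef_S. ring. }
  replace T with (/ INR (S l) * (INR (S l) * T))%C by (field; exact Hl).
  rewrite H. field. exact Hl.
Qed.

(** * Exponential generating functions of bounded sequences *)

(** A quadratic remainder is what a tail estimate for a Taylor series provides, so power series can
    be differentiated without a theorem on termwise differentiation. *)
Lemma curve_derive_of_quadratic (f : R -> C) (x K : R) (l : C) :
  (forall d, Rabs d <= 1 -> Cmod (f (x + d)%R - f x - d * l) <= K * d ^ 2) ->
  curve_derive f x l.
Proof.
intros H.
assert (A : forall (p : R -> R) (m : R),
  (forall d, Rabs d <= 1 -> Rabs (p (x + d) - p x - d * m) <= K * d ^ 2) ->
  is_derive p x m).
{ intros p m Hp. apply is_derive_Reals. intros eps He.
  assert (HK := Rabs_pos K).
  assert (Hd : 0 < Rmin 1 (eps / (Rabs K + 1))).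
  { apply Rmin_pos; [lra|]. apply Rdiv_lt_0_compat; lra. }
  exists (mkposreal _ Hd). intros h Hh0 Hh. simpl in Hh.
  assert (H1 : Rabs h < 1) by (eapply Rlt_le_trans; [exact Hh|apply Rmin_l]).
  assert (H2 : Rabs h < eps / (Rabs K + 1))
    by (eapply Rlt_le_trans; [exact Hh|apply Rmin_r]).
  specialize (Hp h ltac:(lra)).
  replace ((p (x + h) - p x) / h - m) with ((p (x + h) - p x - h * m) / h)
    by (field; exact Hh0).
  assert (Hpos : 0 < Rabs h) by now apply Rabs_pos_lt.
  unfold Rdiv. rewrite Rabs_mult, Rabs_inv.
  apply (Rmult_lt_reg_r (Rabs h)); [exact Hpos|].
  rewrite Rmult_assoc, Rinv_l, Rmult_1_r by lra.
  assert (H3 : Rabs h * (Rabs K + 1) < eps).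
  { replace eps with (eps / (Rabs K + 1) * (Rabs K + 1)) by (field; lra).
    apply Rmult_lt_compat_r; lra. }
  assert (H4 : K * h ^ 2 <= Rabs K * (Rabs h * Rabs h)).
  { replace (h ^ 2) with (Rabs h * Rabs h) by (rewrite <- Rabs_mult, Rabs_pos_eq; nra).
    apply Rmult_le_compat_r; [nra|apply Rle_abs]. }
  nra. }
split; apply A; intros d Hd; specialize (H d Hd).
- eapply Rle_trans; [|exact H]. eapply Rle_trans; [|apply re_le_Cmod].
  right. f_equal. unfold Re. simpl. ring.
- eapply Rle_trans; [|exact H]. eapply Rle_trans; [|apply im_le_Cmod].
  right. f_equal. simpl. ring.
Qed.

Lemma exp_quadratic (y : R) : 0 <= y -> exp y - 1 - y <= y ^ 2 * exp y.
Proof.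
intros Hy.
assert (H1 : forall t, 0 <= t <= y -> Rabs (exp t - exp 0) <= exp y * (t - 0)).
{ intros t Ht. apply (real_mean_value exp exp); [lra|]. intros r Hr. split.
  - apply is_derive_Reals, derivable_pt_lim_exp.
  - rewrite Rabs_pos_eq by (left; apply exp_pos). apply exp_le_compat. lra. }
assert (H2 := real_mean_value (fun t => exp t - t) (fun t => exp t - 1) 0 y
  (exp y * y) Hy).
apply Rle_trans with (exp y * y * (y - 0)); [|right; ring].
eapply Rle_trans; [|apply H2].
- rewrite exp_0. eapply Rle_trans; [|apply Rle_abs]. lra.
- intros t Ht. split; [auto_derive; [exact I|ring]|].
  replace (exp t - 1) with (exp t - exp 0) by (rewrite exp_0; ring). eapply Rle_trans; [now apply H1|].
  apply Rmult_le_compat_l; [left; apply exp_pos|lra].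
Qed.

(** The entire function with derivatives [a] at 0; the shift [j] encodes its [j]-th derivative, so
    that differentiation is mere reindexing. *)
Definition egf (a : nat -> C) (j : nat) (w : C) : C :=
  Cseries (fun n => exp_coef w n * a (j + n)%nat)%C.

Lemma Csum_RtoC (f : nat -> R) (n : nat) :
  Csum (fun k => RtoC (f k)) n = RtoC (sum_f_R0 f n).
Proof.
induction n as [|n IH]; [now rewrite Csum_O|].
now rewrite Csum_S, IH, tech5, RtoC_plus.
Qed.

Lemma logistic_exp_coef (r : R) (l : nat) :
  (Csum (fun i => RtoC (logistic_coef i * r ^ i) * exp_coef r (l - i)%nat) l
   + RtoC (logistic_coef l * r ^ l))%C = RtoC (if Nat.eqb l 0 then 1 else 0).
Proof.
rewrite (Csum_ext _ (fun i => RtoC (logistic_coef i * / INR (fact (l - i)) * r ^ l))).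
- rewrite Csum_RtoC, <- RtoC_plus. f_equal.
  rewrite <- scal_sum, (Rmult_comm (logistic_coef l)), <- Rmult_plus_distr_l.
  rewrite Rplus_comm, logistic_exp_convolution.
  destruct l; simpl; ring.
- intros i Hi. unfold exp_coef.
  rewrite <- RtoC_pow, <- RtoC_div, <- RtoC_mult by apply INR_fact_neq_0.
  f_equal. replace (r ^ l) with (r ^ i * r ^ (l - i))
    by (rewrite <- pow_add; f_equal; lia).
  unfold Rdiv. ring.
Qed.

Lemma ex_series_logistic (x : R) : 0 <= x < PI ->
  ex_series (fun k => Rabs (logistic_coef k) * x ^ k).
Proof.
intros Hx. destruct (logistic_sum_bound x Hx) as [A HA].
assert (P : forall k, 0 <= Rabs (logistic_coef k) * x ^ k)
  by (intros k; apply Rmult_le_pos; [apply Rabs_pos|apply pow_le; lra]).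
destruct (ex_finite_lim_seq_incr
  (fun n => sum_f_R0 (fun k => Rabs (logistic_coef k) * x ^ k) n) A) as [l Hl].
- intros n. simpl. generalize (P (S n)). simpl. lra.
- exact HA.
- exists l. now apply is_series_partial_sums.
Qed.

Section Egf.
Variables (a : nat -> C) (M : R).
Hypothesis a_bound : forall n, Cmod (a n) <= M.

Lemma exp_coef_dominated (w : C) (u : nat -> C) (B : R) :
  (forall n, Cmod (u n) <= B) ->
  forall n, Cmod (exp_coef w n * u n) <= Cmod (exp_coef w n) * B.
Proof.
intros Hu n. rewrite Cmod_mult.
apply Rmult_le_compat_l; [apply Cmod_ge_0|apply Hu].
Qed.

Lemma is_series_exp_coef_scal (w : C) (B : R) :
  is_series (fun n => Cmod (exp_coef w n) * B) (exp (Cmod w) * B).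
Proof. exact (is_series_scal_r B _ _ (is_series_exp_coef w)). Qed.

Lemma egf_correct (j : nat) (w : C) :
  Cconv (Csum (fun n => exp_coef w n * a (j + n)%nat)%C) (egf a j w).
Proof.
apply (Cseries_correct _ _ _
  (exp_coef_dominated w (fun n => a (j + n)%nat) M (fun n => a_bound _))
  (is_series_exp_coef_scal w M)).
Qed.

Lemma Cmod_egf_le (j : nat) (w : C) : Cmod (egf a j w) <= exp (Cmod w) * M.
Proof.
apply (Cmod_Cseries_le _ _ _
  (exp_coef_dominated w (fun n => a (j + n)%nat) M (fun n => a_bound _))
  (is_series_exp_coef_scal w M)).
Qed.

(** Re-expansion about [v]: the Cauchy product of the two exponential series, rearranged by absolute
    convergence. Derivatives, the bound off the real axis and the inversion of 1 + exp (r D) all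
    rest on it. *)
Lemma egf_taylor (j : nat) (k v : C) :
  egf a j (k + v) = Cseries (fun n => exp_coef k n * egf a (j + n) v)%C.
Proof.
apply (Cconv_unique (Csum (fun l => exp_coef (k + v) l * a (j + l)%nat)%C));
  [apply egf_correct|].
assert (H := Cseries_convolution (exp_coef k) (exp_coef v)
  (fun l => a (j + l)%nat) M _ _ (is_series_exp_coef k) (is_series_exp_coef v)
  (fun n => a_bound _)).
erewrite Cseries_ext; [eapply Cconv_ext; [|exact H]|].
- intros n. apply Csum_ext. intros l _. now rewrite exp_coef_plus.
- intros n. simpl. f_equal. unfold egf. apply Cseries_ext. intros m.
  now rewrite Nat.add_assoc.
Qed.

Lemma curve_derive_egf (j : nat) (p k : C) (x : R) :
  curve_derive (fun t => egf a j (p + t * k)) x (k * egf a (S j) (p + x * k)).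
Proof.
set (B := exp (Cmod (p + x * k)) * M).
set (c := Cmod k). assert (Hc : 0 <= c) by apply Cmod_ge_0.
assert (HB : 0 <= B) by (eapply Rle_trans; [apply Cmod_ge_0|apply (Cmod_egf_le 0)]).
apply curve_derive_of_quadratic with (K := c ^ 2 * exp c * B).
intros d Hd.
replace (p + (x + d)%R * k)%C with (d * k + (p + x * k))%C
  by (rewrite RtoC_plus; ring).
rewrite egf_taylor.
(* The terms of index 0 and 1 are the value and the linear part; the rest is dominated by [B] times
   exp (|d| c) - 1 - |d| c. *)
assert (T := Cseries_tail _ _ _
  (exp_coef_dominated (d * k) (fun n => egf a (j + n) (p + x * k)) B
    (fun n => Cmod_egf_le _ _)) (is_series_exp_coef_scal (d * k) B) 1).
rewrite Csum_S, Csum_O in T. simpl sum_f_R0 in T.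
rewrite !Cmod_exp_coef, exp_coef_O in T.
replace (exp_coef (d * k) 1) with (d * k)%C in T
  by (unfold exp_coef; simpl; Cfield).
simpl pow in T. simpl fact in T. change (INR 1) with 1 in T.
rewrite Nat.add_0_r, Nat.add_1_r in T.
rewrite Cmod_mult, Cmod_R in T. fold c in T.
match goal with |- Cmod ?z <= _ => match type of T with Cmod ?y <= _ =>
  replace z with y by ring end end.
eapply Rle_trans; [exact T|].
assert (Q := exp_quadratic (Rabs d * c)
  ltac:(apply Rmult_le_pos; [apply Rabs_pos|exact Hc])).
assert (E : exp (Rabs d * c) <= exp c).
{ apply exp_le_compat. rewrite <- (Rmult_1_l c) at 2.
  apply Rmult_le_compat_r; lra. }
replace (d ^ 2) with (Rabs d ^ 2) by (rewrite pow2_abs; ring).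
apply Rle_trans with ((exp (Rabs d * c) - 1 - Rabs d * c) * B); [right; field|].
replace (c ^ 2 * exp c * B * Rabs d ^ 2) with ((Rabs d * c) ^ 2 * exp c * B) by ring.
apply Rmult_le_compat_r; [exact HB|].
eapply Rle_trans; [exact Q|].
apply Rmult_le_compat_l; [apply pow_le, Rmult_le_pos; [apply Rabs_pos|exact Hc]|].
exact E.
Qed.

Hypothesis real_bound : forall j (x : R), Cmod (egf a j x) <= M.

(** Expansion in the imaginary direction about the real point Re w, where all derivatives share the
    bound [M]. This takes the place of a Phragmen-Lindelof argument. *)
Lemma egf_strip_bound (j : nat) (w : C) :
  Cmod (egf a j w) <= exp (Rabs (Im w)) * M.
Proof.
replace w with (Ci * Im w + Re w)%C.
2:{ destruct w as [x y]. unfold Ci, RtoC, Cmult, Cplus. simpl. f_equal; ring. }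
rewrite egf_taylor.
replace (Rabs (Im (Ci * Im w + Re w))) with (Cmod (Ci * Im w)).
2:{ rewrite Cmod_mult, Cmod_Ci, Cmod_R. simpl. rewrite Rmult_1_l. f_equal. ring. }
apply (Cmod_Cseries_le _ _ _
  (exp_coef_dominated (Ci * Im w) (fun n => egf a (j + n) (Re w)) M
    (fun n => real_bound _ _)) (is_series_exp_coef_scal _ M)).
Qed.

(* The series [Sum_j c_j r^j D^j], where [1 / (1 + exp w) = Sum_j c_j w^j] and
   [D] is differentiation, inverts [1 + exp (r D)]. *)
Definition half_inverse (r : R) (j : nat) (w : C) : C :=
  Cseries (fun n => RtoC (logistic_coef n * r ^ n) * egf a (j + n) w)%C.

(** The translate by [r] is exp (r D), so its series is a convolution of the logistic and
    exponential coefficients. Adding the untranslated series leaves the coefficient 1 at order 0 and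
    0 at all others. *)
Lemma half_inverse_correct (r : R) (j : nat) (w : C) : 0 <= r < PI ->
  (half_inverse r j (w + r) + half_inverse r j w)%C = egf a j w.
Proof.
intros Hr.
set (B := exp (Cmod w) * M).
set (al := fun n => RtoC (logistic_coef n * r ^ n)).
destruct (ex_series_logistic r Hr) as [s Hs].
assert (Hal : is_series (fun n => Cmod (al n)) s).
{ revert Hs. apply is_series_ext. intros n. unfold al.
  rewrite Cmod_R, Rabs_mult, (Rabs_pos_eq (r ^ n)); [reflexivity|].
  apply pow_le; lra. }
assert (H1 := Cseries_convolution al (exp_coef r)
  (fun l => egf a (j + l) w) B _ _ Hal (is_series_exp_coef r)
  (fun n => Cmod_egf_le _ _)).
assert (E1 : half_inverse r j (w + r) = Cseries (fun n => al n *
  Cseries (fun m => exp_coef r m * egf a (j + (n + m)) w))%C).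
{ apply Cseries_ext. intros n. fold (al n). f_equal.
  rewrite Cplus_comm, egf_taylor. apply Cseries_ext. intros m.
  now rewrite Nat.add_assoc. }
cbv beta in H1. rewrite <- E1 in H1.
assert (H2 : Cconv (Csum (fun n => al n * egf a (j + n) w)%C)
  (half_inverse r j w)).
{ apply (Cseries_correct _ (fun n => Cmod (al n) * B) (s * B)).
  - intros n. rewrite Cmod_mult.
    apply Rmult_le_compat_l; [apply Cmod_ge_0|apply Cmod_egf_le].
  - exact (is_series_scal_r B _ _ Hal). }
apply (Cconv_unique _ _ _ (Cconv_plus _ _ _ _ H1 H2)).
(* The combined partial sums are all equal to the limit already, hence the threshold 0. *)
intros eps He. exists 0%nat. intros n _.
rewrite <- Csum_plus.
assert (E2 : forall l,
  (Csum (fun i => al i * exp_coef r (l - i)%nat) l * egf a (j + l) w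
   + al l * egf a (j + l) w)%C
  = (RtoC (if Nat.eqb l 0 then 1 else 0) * egf a (j + l) w)%C).
{ intros l. rewrite <- (logistic_exp_coef r l). fold (al l).
  rewrite Cmult_plus_distr_r. reflexivity. }
rewrite (Csum_single (egf a j w) 0); [|lia| |].
- unfold Cminus. now rewrite Cplus_opp_r, Cmod_0.
- rewrite E2, Nat.add_0_r. simpl Nat.eqb. cbv iota. ring.
- intros l Hl. rewrite E2. destruct l; [lia|]. simpl Nat.eqb. cbv iota. ring.
Qed.
End Egf.

(** * The homotopy estimate *)

Lemma pow_m1_even (N : nat) : ((-1) ^ (2 * N))%C = 1.
Proof.
rewrite Cpow_mult_r. replace ((-1) ^ 2)%C with (RtoC 1); [apply Cpow_1_l|].
simpl. ring.
Qed.

Lemma Cmod_pow_m1 (N : nat) : Cmod ((-1) ^ N)%C = 1.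
Proof. rewrite Cmod_pow, Cmod_R, Rabs_left by lra.
replace (- -1) with 1 by ring. apply pow1.
Qed.

Section Homotopy.
Variables (a : nat -> C) (M : R).
Hypothesis a_bound : forall n, Cmod (a n) <= M.
Hypothesis real_bound : forall j (x : R), Cmod (egf a j x) <= M.
Variable rho : R.
Hypothesis Hrho : 0 <= rho < PI.
Variables (SL A : R).
Hypothesis HS : is_series (fun n => Rabs (logistic_coef n) * rho ^ n) SL.
Hypothesis HA : forall n,
  sum_f_R0 (fun k => Rabs (logistic_coef k) * (INR k * rho ^ pred k)) n <= A.
Variables (B : R) (u : C) (N : nat).
Hypothesis HB : Cmod u <= B.
Hypothesis HN : B < INR N.

Let M1 := exp (PI * B) * M.

Lemma SL_pos : 0 <= SL.
Proof.
apply Rle_trans with (sum_f_R0 (fun n => Rabs (logistic_coef n) * rho ^ n) 0).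
- simpl. rewrite Rmult_1_r. apply Rabs_pos.
- apply (partial_sums_le (fun n => RtoC (Rabs (logistic_coef n) * rho ^ n)));
    [|exact HS].
  intros n. rewrite Cmod_R, Rabs_pos_eq; [lra|].
  apply Rmult_le_pos; [apply Rabs_pos|apply pow_le; lra].
Qed.

Lemma A_pos : 0 <= A.
Proof. generalize (HA 0). simpl. lra. Qed.

(* [s = 1] gives the sampling sum; [s = 0] freezes the function at [u]. *)
Local Definition homotopy (s : R) : C :=
  Csum (fun j => egf a 0 (rho * u + s * (rho * (node N j - u)))
                 * sinc (u - node N j))%C (2 * N).

Local Definition point (k : C) (s : R) : C := (rho * u + s * (rho * k))%C.

(** The part of (u - k) sinc (u - k) shared by all nodes. The sign (-1)^N appears because indices
    are counted from the node -N. *)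
Local Definition amplitude : C := ((-1) ^ N * Csin (PI * u) / PI)%C.

(** For a real node [x] the imaginary part is rho (1 - s) Im u, whatever [x] is. The bound therefore
    stays the same as the nodes recede with [N]. *)
Lemma point_bound (j : nat) (x : R) (s : R) : 0 <= s <= 1 ->
  Cmod (egf a j (point (x - u) s)) <= M1.
Proof.
intros Hs.
assert (HM : 0 <= M) by (eapply Rle_trans; [apply Cmod_ge_0|apply (a_bound 0)]).
eapply Rle_trans; [apply (egf_strip_bound a M a_bound real_bound)|].
apply Rmult_le_compat_r; [exact HM|]. apply exp_le_compat.
replace (Im (point (x - u) s)) with (rho * (1 - s) * Im u)
  by (unfold point; destruct u as [ux uy]; simpl; ring).
assert (Hi := im_le_Cmod u). fold (Im u) in Hi.
rewrite Rabs_mult, Rabs_pos_eq by nra.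
assert (0 <= Rabs (Im u)) by apply Rabs_pos.
apply Rmult_le_compat; try nra.
Qed.

Lemma curve_derive_homotopy (s : R) : 0 <= s <= 1 ->
  curve_derive homotopy s
   (- (rho * amplitude
      * (half_inverse a (s * rho) 1 (point (INR N + 1 - u) s)
         + half_inverse a (s * rho) 1 (point (- INR N - u) s))))%C.
Proof.
intros Hs.
eapply curve_derive_eq; [|apply (curve_derive_sum
  (fun j s => egf a 0 (rho * u + s * (rho * (node N j - u)))
                 * sinc (u - node N j))%C)].
2:{ intros k Hk.
  apply (curve_derive_ext (fun s => sinc (u - node N k)
    * egf a 0 (rho * u + s * (rho * (node N k - u))))%C); [intros; ring|].
  apply curve_derive_scal, (curve_derive_egf a M a_bound). }
set (h := fun j => half_inverse a (s * rho) 1 (point (node N j - u) s)).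
rewrite (Csum_ext _ (fun j => - (rho * amplitude)
   * ((-1) ^ j * (h (S j) + h j)))%C).
(* The 2N + 1 nodes give the end indices 2N + 1 and 0, that is, N + 1 and -N: hence the asymmetry of
   the two end terms. Both carry the sign + because 2N is even. *)
- rewrite Csum_scal, Csum_alternating_telescope, pow_m1_even.
  unfold h. rewrite node_S, node_last, node_O. ring.
- intros j Hj. unfold h.
  replace (point (node N (S j) - u) s)
    with (point (node N j - u) s + (s * rho)%R)%C
    by (unfold point; rewrite node_S, RtoC_mult; ring).
  rewrite half_inverse_correct with (M := M) by (try exact a_bound; nra).
  fold (point (node N j - u) s).
  replace (sinc (u - node N j) * (rho * (node N j - u)
     * egf a 1 (point (node N j - u) s)))%C
    with (- (rho * (PI * (u - node N j) * sinc (u - node N j)) / PI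
      * egf a 1 (point (node N j - u) s)))%C by Cfield.
  rewrite mult_sinc, sin_node. unfold amplitude. Cfield.
Qed.

(** * Cancelling the end terms with finite sums *)

Section Truncation.
Variable J : nat.

(** The function for the integration by parts: differentiating the [egf] factor yields rho k times
    the truncated end term, while differentiating s^n yields [corrector'], without a factor [k].
    Division by [k] then gains 1 / N. Being a finite sum, it is differentiated term by term. *)
Local Definition corrector (k : C) (s : R) : C :=
  Csum (fun n => RtoC (s ^ n)
    * (RtoC (logistic_coef n * rho ^ n) * egf a n (point k s)))%C J.

Local Definition corrector' (k : C) (s : R) : C :=
  Csum (fun n => RtoC (INR n * s ^ pred n)
    * (RtoC (logistic_coef n * rho ^ n) * egf a n (point k s)))%C J.

Local Definition truncated_half_inverse (k : C) (s : R) : C :=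
  Csum (fun n => RtoC (logistic_coef n * (s * rho) ^ n)
     * egf a (1 + n) (point k s))%C J.

Lemma curve_derive_corrector (k : C) (s : R) :
  curve_derive (corrector k) s
    (corrector' k s + rho * k * truncated_half_inverse k s)%C.
Proof.
eapply curve_derive_eq; [|apply (curve_derive_sum
  (fun n s => RtoC (s ^ n) * (RtoC (logistic_coef n * rho ^ n)
     * egf a n (point k s)))%C)].
2:{ intros n Hn. apply curve_derive_mult; [apply curve_derive_pow|].
  apply curve_derive_scal, (curve_derive_egf a M a_bound). }
unfold corrector', truncated_half_inverse.
rewrite <- Csum_scal, <- Csum_plus. apply Csum_ext. intros n Hn.
fold (point k s). change (1 + n)%nat with (S n).
rewrite Rpow_mult_distr, !RtoC_mult. ring.
Qed.

Lemma Cmod_corrector' (x s : R) : 0 <= s <= 1 ->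
  Cmod (corrector' (x - u) s) <= rho * (A * M1).
Proof.
intros Hs.
assert (HM1 : 0 <= M1)
  by (eapply Rle_trans; [apply Cmod_ge_0|apply (point_bound 0 0 0); lra]).
apply Rle_trans with (sum_f_R0 (fun k =>
  Rabs (logistic_coef k) * (INR k * rho ^ pred k) * (rho * M1)) J).
- apply Csum_bound. intros n Hn.
  rewrite !Cmod_mult, !Cmod_R, Rabs_mult, (Rabs_mult (logistic_coef n)).
  rewrite (Rabs_pos_eq (INR n)) by apply pos_INR.
  rewrite (Rabs_pos_eq (s ^ _)), (Rabs_pos_eq (rho ^ _)) by (apply pow_le; lra).
  assert (P := pos_INR n). assert (Q := Rabs_pos (logistic_coef n)).
  assert (T := point_bound n x s Hs).
  assert (S1 : 0 <= s ^ pred n <= 1).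
  { split; [apply pow_le; lra|]. rewrite <- (pow1 (pred n)). apply pow_incr. lra. }
  replace (INR n * rho ^ pred n) with (INR n * 1 * rho ^ pred n) by ring.
  assert (R1 : INR n * rho ^ n = INR n * (rho ^ pred n * rho))
    by (destruct n; simpl; ring).
  assert (R0 : 0 <= rho ^ n) by (apply pow_le; lra).
  apply Rle_trans with (INR n * 1 * (Rabs (logistic_coef n) * rho ^ n * M1)).
  + apply Rmult_le_compat.
    * apply Rmult_le_pos; lra.
    * apply Rmult_le_pos; [now apply Rmult_le_pos|apply Cmod_ge_0].
    * apply Rmult_le_compat_l; lra.
    * apply Rmult_le_compat_l; [now apply Rmult_le_pos|exact T].
  + right. transitivity (Rabs (logistic_coef n) * M1 * (INR n * rho ^ n)); [ring|].
    rewrite R1. ring.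
- rewrite <- scal_sum. replace (rho * (A * M1)) with (rho * M1 * A) by ring.
  apply Rmult_le_compat_l; [apply Rmult_le_pos; lra|apply HA].
Qed.

Lemma Cmod_corrector (x s : R) : 0 <= s <= 1 ->
  Cmod (corrector (x - u) s) <= SL * M1.
Proof.
intros Hs.
assert (HM1 : 0 <= M1)
  by (eapply Rle_trans; [apply Cmod_ge_0|apply (point_bound 0 0 0); lra]).
apply Rle_trans with
  (sum_f_R0 (fun k => Rabs (logistic_coef k) * rho ^ k * M1) J).
- apply Csum_bound. intros n Hn.
  rewrite !Cmod_mult, !Cmod_R, Rabs_mult.
  rewrite (Rabs_pos_eq (s ^ _)), (Rabs_pos_eq (rho ^ _)) by (apply pow_le; lra).
  assert (S1 : 0 <= s ^ n <= 1).
  { split; [apply pow_le; lra|]. rewrite <- (pow1 n). apply pow_incr. lra. }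
  rewrite <- (Rmult_1_l (Rabs (logistic_coef n) * rho ^ n * M1)).
  assert (R0 : 0 <= rho ^ n) by (apply pow_le; lra).
  assert (Q := Rabs_pos (logistic_coef n)).
  apply Rmult_le_compat; try lra.
  + apply Rmult_le_pos; [now apply Rmult_le_pos|apply Cmod_ge_0].
  + apply Rmult_le_compat_l; [now apply Rmult_le_pos|now apply point_bound].
- rewrite <- scal_sum, Rmult_comm.
  apply Rmult_le_compat_r; [exact HM1|].
  apply (partial_sums_le (fun n => RtoC (Rabs (logistic_coef n) * rho ^ n)));
    [|exact HS].
  intros n. rewrite Cmod_R, Rabs_pos_eq; [lra|].
  apply Rmult_le_pos; [apply Rabs_pos|apply pow_le; lra].
Qed.

Let tail := (SL - sum_f_R0 (fun k => Rabs (logistic_coef k) * rho ^ k) J) * M1.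

Lemma truncation_error (x s : R) : 0 <= s <= 1 ->
  Cmod (half_inverse a (s * rho) 1 (point (x - u) s)
        - truncated_half_inverse (x - u) s) <= tail.
Proof.
intros Hs.
assert (HM1 : 0 <= M1)
  by (eapply Rle_trans; [apply Cmod_ge_0|apply (point_bound 0 0 0); lra]).
unfold tail. rewrite Rmult_minus_distr_r.
rewrite (Rmult_comm (sum_f_R0 _ _)), scal_sum.
apply (Cseries_tail _ (fun k => Rabs (logistic_coef k) * rho ^ k * M1)).
- intros n. rewrite Cmod_mult, Cmod_R, Rabs_mult.
  assert (S1 : 0 <= (s * rho) ^ n <= rho ^ n).
  { split; [apply pow_le; nra|]. apply pow_incr. nra. }
  rewrite (Rabs_pos_eq ((s * rho) ^ n)) by lra.
  apply Rmult_le_compat; [apply Rmult_le_pos; [apply Rabs_pos|lra]|apply Cmod_ge_0| |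
    now apply point_bound].
  apply Rmult_le_compat_l; [apply Rabs_pos|lra].
- exact (is_series_scal_r M1 _ _ HS).
Qed.

Lemma node_distance (x : R) : INR N <= Rabs x ->
  INR N - B <= Cmod (x - u) /\ (x - u)%C <> 0.
Proof.
intros Hx. assert (T := Cmod_triangle_rev x u). rewrite Cmod_R in T.
split; [lra|]. intros E. rewrite E, Cmod_0 in T. lra.
Qed.

Lemma homotopy_variation_truncated :
  Cmod (homotopy 1 - homotopy 0) <=
    Cmod amplitude * (4 * rho * tail
      + (4 * rho * A + 4 * SL) * M1 / (INR N - B)).
Proof.
set (k1 := (RtoC (INR N + 1) - u)%C). set (k0 := (RtoC (- INR N) - u)%C).
assert (N0 := pos_INR N).
destruct (node_distance (INR N + 1)) as [D1 Z1];
  [rewrite Rabs_pos_eq; lra|fold k1 in D1, Z1].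
destruct (node_distance (- INR N)) as [D0 Z0];
  [rewrite Rabs_Ropp, Rabs_pos_eq; lra|fold k0 in D0, Z0].
assert (HM1 : 0 <= M1)
  by (eapply Rle_trans; [apply Cmod_ge_0|apply (point_bound 0 0 0); lra]).
assert (Hd : 0 < INR N - B) by lra.
assert (div_bound : forall v k b, (INR N - B) <= Cmod k -> Cmod v <= b ->
  Cmod (/ k * v) <= b / (INR N - B)).
{ intros v k b Hk Hv. rewrite Cmod_mult, Cmod_inv.
  - rewrite Rmult_comm. apply Rmult_le_compat; [apply Cmod_ge_0| |exact Hv|].
    + left. apply Rinv_0_lt_compat. lra.
    + apply Rinv_le_contravar; lra.
  - apply Cmod_gt_0. lra. }
(* In the derivative of this sum the end terms of [homotopy] cancel up to the truncation errors
   [err], and what else remains is divided by [k1] or [k0]. *)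
set (h := fun s => (homotopy s
  + amplitude * (/ k1 * corrector k1 s + / k0 * corrector k0 s))%C).
set (err := fun k s => (truncated_half_inverse k s
  - half_inverse a (s * rho) 1 (point k s))%C).
set (h' := fun s => (amplitude * (rho * (err k1 s + err k0 s)
  + (/ k1 * corrector' k1 s + / k0 * corrector' k0 s)))%C).
assert (Dh : forall s, 0 <= s <= 1 -> curve_derive h s (h' s)).
{ intros s Hs. eapply curve_derive_eq; [|apply curve_derive_plus;
    [now apply curve_derive_homotopy|
     apply curve_derive_scal, curve_derive_plus; apply curve_derive_scal,
     curve_derive_corrector]].
  unfold h', err.
  replace (INR N + 1 - u)%C with k1 by (unfold k1; now rewrite RtoC_plus).
  replace (- INR N - u)%C with k0 by (unfold k0; now rewrite RtoC_opp).
  field. split; assumption. }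
assert (Bh : forall s, 0 <= s <= 1 -> Cmod (h' s) <=
  Cmod amplitude * (2 * rho * tail + 2 * rho * A * M1 / (INR N - B))).
{ intros s Hs. unfold h'. rewrite Cmod_mult.
  apply Rmult_le_compat_l; [apply Cmod_ge_0|].
  assert (E1 : forall x : R, Cmod (err (x - u)%C s) <= tail).
  { intros x. unfold err.
    replace (truncated_half_inverse (x - u) s
      - half_inverse a (s * rho) 1 (point (x - u) s))%C
      with (- (half_inverse a (s * rho) 1 (point (x - u) s)
      - truncated_half_inverse (x - u) s))%C by ring.
    rewrite Cmod_opp. now apply truncation_error. }
  assert (F1 := div_bound _ k1 _ D1 (Cmod_corrector' (INR N + 1) s Hs)).
  assert (F0 := div_bound _ k0 _ D0 (Cmod_corrector' (- INR N) s Hs)).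
  assert (G1 := E1 (INR N + 1)). assert (G0 := E1 (- INR N)).
  fold k1 in F1, G1. fold k0 in F0, G0.
  eapply Rle_trans; [apply Cmod_triangle|].
  replace (2 * rho * tail + 2 * rho * A * M1 / (INR N - B)) with
    (rho * (tail + tail) + (rho * (A * M1) / (INR N - B)
      + rho * (A * M1) / (INR N - B))) by (field; lra).
  apply Rplus_le_compat.
  - rewrite Cmod_mult, Cmod_R, Rabs_pos_eq by lra.
    apply Rmult_le_compat_l; [lra|].
    eapply Rle_trans; [apply Cmod_triangle|lra].
  - eapply Rle_trans; [apply Cmod_triangle|lra]. }
assert (V := curve_mean_value h h' 0 1 _ Rle_0_1
  (fun t Ht => conj (Dh t Ht) (Bh t Ht))).
assert (Bc : forall s, 0 <= s <= 1 ->
  Cmod (amplitude * (/ k1 * corrector k1 s + / k0 * corrector k0 s))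
  <= Cmod amplitude * (2 * SL * M1 / (INR N - B))).
{ intros s Hs. rewrite Cmod_mult.
  apply Rmult_le_compat_l; [apply Cmod_ge_0|].
  assert (F1 := div_bound _ k1 _ D1 (Cmod_corrector (INR N + 1) s Hs)).
  assert (F0 := div_bound _ k0 _ D0 (Cmod_corrector (- INR N) s Hs)).
  fold k1 in F1. fold k0 in F0.
  eapply Rle_trans; [apply Cmod_triangle|].
  replace (2 * SL * M1 / (INR N - B)) with
    (SL * M1 / (INR N - B) + SL * M1 / (INR N - B)) by (field; lra). lra. }
assert (C1 := Bc 1 ltac:(lra)). assert (C0 := Bc 0 ltac:(lra)).
set (v1 := (amplitude * (/ k1 * corrector k1 1 + / k0 * corrector k0 1))%C) in *.
set (v0 := (amplitude * (/ k1 * corrector k1 0 + / k0 * corrector k0 0))%C) in *.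
replace (homotopy 1 - homotopy 0)%C with ((h 1 - h 0) - (v1 - v0))%C
  by (unfold h, v1, v0; ring).
eapply Rle_trans; [apply Cmod_triangle_minus|].
assert (T := Cmod_triangle_minus v1 v0).
(* The factors 4 count two end terms, doubled by the mean value inequality for [h] and by the two
   boundary values s = 0 and s = 1 of the corrector. *)
replace (Cmod amplitude * (4 * rho * tail
      + (4 * rho * A + 4 * SL) * M1 / (INR N - B))) with
  (2 * (Cmod amplitude * (2 * rho * tail + 2 * rho * A * M1 / (INR N - B))) * (1 - 0)
   + 2 * (Cmod amplitude * (2 * SL * M1 / (INR N - B)))) by (field; lra).
lra.
Qed.

End Truncation.

(** With [N] and [u] fixed, the truncated estimate holds for every [J], and only its tail depends on
    [J]; the tail vanishes in the limit. *)
Lemma homotopy_variation :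
  Cmod (homotopy 1 - homotopy 0) <=
    Cmod amplitude * ((4 * rho * A + 4 * SL) * M1 / (INR N - B)).
Proof.
assert (L : is_lim_seq (fun J => Cmod amplitude * (4 * rho *
   ((SL - sum_f_R0 (fun k => Rabs (logistic_coef k) * rho ^ k) J) * M1)
      + (4 * rho * A + 4 * SL) * M1 / (INR N - B)))
  (Cmod amplitude * (4 * rho * ((SL - SL) * M1)
      + (4 * rho * A + 4 * SL) * M1 / (INR N - B)))).
{ apply is_series_partial_sums in HS.
  apply is_lim_seq_mult'; [apply is_lim_seq_const|].
  apply is_lim_seq_plus'; [|apply is_lim_seq_const].
  apply is_lim_seq_mult'; [apply is_lim_seq_const|].
  apply is_lim_seq_mult'; [|apply is_lim_seq_const].
  apply is_lim_seq_minus'; [apply is_lim_seq_const|exact HS]. }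
replace ((4 * rho * A + 4 * SL) * M1 / (INR N - B)) with
  (4 * rho * ((SL - SL) * M1) + (4 * rho * A + 4 * SL) * M1 / (INR N - B)) by ring.
refine (is_lim_seq_le (fun _ => Cmod (homotopy 1 - homotopy 0)) _ _ _ _
  (is_lim_seq_const _) L).
intros J. apply homotopy_variation_truncated.
Qed.

Lemma Cmod_amplitude : Cmod amplitude <= exp (PI * B).
Proof.
unfold amplitude. assert (P := PI2_3_2).
rewrite Cmod_div by apply PI_C_neq_0.
rewrite Cmod_mult, Cmod_pow_m1, Rmult_1_l, Cmod_R, Rabs_pos_eq by lra.
apply Rle_trans with (Cmod (Csin (PI * u)) / 1).
- apply Rmult_le_compat_l; [apply Cmod_ge_0|apply Rinv_le_contravar; lra].
- unfold Rdiv. rewrite Rinv_1, Rmult_1_r.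
  eapply Rle_trans; [apply Cmod_sin_le|]. apply exp_le_compat.
  rewrite Cmod_mult, Cmod_R, Rabs_pos_eq by lra.
  apply Rmult_le_compat_l; lra.
Qed.

Lemma sampling_error :
  Cmod (Csum (fun j => egf a 0 (rho * node N j) * sinc (u - node N j))%C (2 * N)
        - egf a 0 (rho * u))
  <= (exp (PI * B) * (4 * rho * A + 4 * SL) + 168 * (B ^ 2 * exp (PI * B)))
     * M1 / (INR N - B).
Proof.
assert (HM1 : 0 <= M1)
  by (eapply Rle_trans; [apply Cmod_ge_0|apply (point_bound 0 0 0); lra]).
assert (B0 : 0 <= B) by (eapply Rle_trans; [apply Cmod_ge_0|exact HB]).
assert (e0 := exp_pos (PI * B)).
assert (B2 : 0 <= B ^ 2 * exp (PI * B)) by (apply Rmult_le_pos; nra).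
assert (H0 : homotopy 0 = (egf a 0 (rho * u)
  * Csum (fun j => sinc (u - node N j)) (2 * N))%C).
{ unfold homotopy. rewrite <- Csum_scal. apply Csum_ext. intros j _.
  f_equal. f_equal. ring. }
assert (H1 : homotopy 1 =
  Csum (fun j => egf a 0 (rho * node N j) * sinc (u - node N j))%C (2 * N)).
{ unfold homotopy. apply Csum_ext. intros j _. f_equal. f_equal. ring. }
rewrite <- H1.
replace (homotopy 1 - egf a 0 (rho * u))%C with
  ((homotopy 1 - homotopy 0)
   + egf a 0 (rho * u) * (Csum (fun j => sinc (u - node N j)) (2 * N) - 1))%C
  by (rewrite H0; ring).
eapply Rle_trans; [apply Cmod_triangle|].
replace ((exp (PI * B) * (4 * rho * A + 4 * SL) + 168 * (B ^ 2 * exp (PI * B)))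
     * M1 / (INR N - B)) with
  (exp (PI * B) * ((4 * rho * A + 4 * SL) * M1 / (INR N - B))
   + M1 * (168 * (B ^ 2 * exp (PI * B)) / (INR N - B)))
  by (unfold Rdiv; ring).
apply Rplus_le_compat.
- eapply Rle_trans; [apply homotopy_variation|].
  apply Rmult_le_compat_r; [|apply Cmod_amplitude].
  assert (A0 := A_pos). assert (S0 := SL_pos).
  assert (0 <= rho * A) by (apply Rmult_le_pos; lra).
  apply Rdiv_le_0_compat; [apply Rmult_le_pos; lra|lra].
- rewrite Cmod_mult.
  apply Rmult_le_compat; [apply Cmod_ge_0|apply Cmod_ge_0| |].
  (* At s = 0 the point is rho u for any node, so the node 0 will do. *)
  + assert (Q := point_bound 0 0 0 ltac:(lra)). unfold point in Q.
    replace (rho * u)%C with (rho * u + 0 * (rho * (0 - u)))%C by ring. exact Q.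
  + eapply Rle_trans; [apply sinc_sum_near_1, HB|].
    apply Rmult_le_compat_l; [lra|]. apply Rinv_le_contravar; lra.
Qed.

End Homotopy.

(** * Isometry groups and Bernstein vectors *)

Lemma sampling_error_uniform (a : nat -> C) (M rho B : R) :
  (forall n, Cmod (a n) <= M) ->
  (forall j (x : R), Cmod (egf a j x) <= M) ->
  0 <= rho < PI ->
  exists K, forall (N : nat) (u : C), Cmod u <= B -> B < INR N ->
    Cmod (Csum (fun j => egf a 0 (rho * node N j) * sinc (u - node N j))%C
            (2 * N) - egf a 0 (rho * u)) <= K / (INR N - B).
Proof.
intros Ha Hr Hrho.
destruct (ex_series_logistic rho Hrho) as [S HS].
destruct (logistic_derive_sum_bound rho Hrho) as [A HA].
(* The witness is left open before [N] and [u] are introduced, which certifies that it depends on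
   neither. *)
eexists. intros N u Hu HN.
exact (sampling_error a M Ha Hr rho Hrho S A HS HA B u N Hu HN).
Qed.

Lemma exp_coef_R (x : R) (n : nat) :
  exp_coef x n = RtoC (x ^ n / INR (fact n)).
Proof.
unfold exp_coef. now rewrite RtoC_div, RtoC_pow by apply INR_fact_neq_0.
Qed.

Lemma exp_coef_0_S (n : nat) : exp_coef 0 (S n) = 0.
Proof. unfold exp_coef. rewrite Cpow_S. unfold Cdiv. ring. Qed.

Lemma curve_derive_exp_coef (t s : R) (n : nat) :
  curve_derive (fun s => exp_coef (t - s)%R (S n)) s (- exp_coef (t - s)%R n)%C.
Proof.
apply (curve_derive_ext (fun s => RtoC ((t - s) ^ S n / INR (fact (S n)))));
  [intros; now rewrite exp_coef_R|].
rewrite exp_coef_R, <- RtoC_opp. apply curve_derive_RtoC.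
assert (H := INR_fact_neq_0 n). assert (H' := not_0_INR (S n) ltac:(lia)).
rewrite fact_simpl, mult_INR. set (c := INR (fact n)) in *.
set (d := INR (S n)) in *.
auto_derive; [exact I|]. simpl pred. change (t + - s) with (t - s).
match goal with |- context [?m * (t - s) ^ n] => change m with d end.
field. split; assumption.
Qed.

(** * Taylor series on the real line *)

Section Taylor.
Variables (phi : nat -> R -> C) (K tau : R).
Hypothesis phi_derive : forall m t, curve_derive (phi m) t (phi (S m) t).
Hypothesis phi_bound : forall m t, Cmod (phi m t) <= tau ^ m * K.

(** When the centre of a Taylor polynomial moves, the contributions of neighbouring orders cancel
    and only the top one survives. *)
Lemma curve_derive_taylor_sum (t s : R) (n : nat) :
  curve_derive (fun s => Csum (fun m => exp_coef (t - s)%R m * phi m s)%C n) s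
    (exp_coef (t - s)%R n * phi (S n) s)%C.
Proof.
induction n as [|n IH].
- rewrite exp_coef_O.
  apply (curve_derive_ext (phi 0%nat)).
  + intros r. rewrite Csum_O, exp_coef_O. ring.
  + eapply curve_derive_eq; [|apply phi_derive]. ring.
- apply (curve_derive_ext (fun s =>
    Csum (fun m => exp_coef (t - s)%R m * phi m s) n
    + exp_coef (t - s)%R (S n) * phi (S n) s)%C);
    [intros r; now rewrite Csum_S|].
  eapply curve_derive_eq; [|apply curve_derive_plus; [exact IH|
    apply curve_derive_mult; [apply curve_derive_exp_coef|apply phi_derive]]].
  cbv beta. ring.
Qed.

(** The Taylor polynomial with centre [s], evaluated at [t], is the function value for s = t and the
    partial sum for s = 0. The mean value inequality between these two centres is the remainder
    estimate, for either sign of [t]. *)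
Lemma taylor_series (t : R) :
  Cconv (Csum (fun n => exp_coef t n * phi n 0)%C) (phi 0%nat t).
Proof.
assert (HK : 0 <= K).
{ generalize (Cmod_ge_0 (phi 0%nat 0)) (phi_bound 0 0). simpl. lra. }
apply (Cconv_close (fun _ => phi 0%nat t) _
  (fun n => 2 * (tau * K) * Rabs t * ((Rabs t * tau) ^ n / INR (fact n)))).
- intros eps He. exists 0%nat. intros n _. unfold Cminus.
  now rewrite Cplus_opp_r, Cmod_0.
- intros n.
  set (H := fun s => Csum (fun m => exp_coef (t - s)%R m * phi m s)%C n).
  assert (Ht : H t = phi 0%nat t).
  { unfold H. apply (Csum_single _ 0); [lia| |].
    - rewrite exp_coef_O. ring.
    - intros j Hj. destruct j; [lia|].
      replace (t - t) with 0 by ring. rewrite exp_coef_0_S. ring. }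
  assert (H0 : H 0 = Csum (fun n => exp_coef t n * phi n 0)%C n).
  { unfold H. apply Csum_ext. intros m _. now rewrite Rminus_0_r. }
  rewrite <- H0, <- Ht.
  set (b := (Rabs t * tau) ^ n / INR (fact n) * (tau * K)).
  assert (Hb : forall s, Rabs (t - s) <= Rabs t ->
    Cmod (exp_coef (t - s)%R n * phi (S n) s) <= b).
  { intros s Hs. rewrite Cmod_mult, Cmod_exp_coef, Cmod_R. unfold b.
    assert (F := INR_fact_lt_0 n).
    apply Rle_trans with (Rabs t ^ n / INR (fact n) * (tau ^ S n * K)).
    - apply Rmult_le_compat; [|apply Cmod_ge_0| |apply phi_bound].
      + apply Rdiv_le_0_compat; [apply pow_le, Rabs_pos|exact F].
      + apply Rmult_le_compat_r; [left; now apply Rinv_0_lt_compat|].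
        apply pow_incr. split; [apply Rabs_pos|exact Hs].
    - right. rewrite Rpow_mult_distr. simpl. field. lra. }
  replace (2 * (tau * K) * Rabs t * ((Rabs t * tau) ^ n / INR (fact n)))
    with (2 * b * Rabs t) by (unfold b; ring).
  destruct (Rle_dec 0 t) as [Hpos|Hneg].
  + replace (H 0 - H t)%C with (- (H t - H 0))%C by ring. rewrite Cmod_opp.
    rewrite (Rabs_pos_eq t Hpos). replace (2 * b * t) with (2 * b * (t - 0)) by ring.
    apply (curve_mean_value H (fun s => exp_coef (t - s)%R n * phi (S n) s)%C);
      [exact Hpos|].
    intros s Hs. split; [apply curve_derive_taylor_sum|apply Hb].
    rewrite !Rabs_pos_eq; lra.
  + rewrite (Rabs_left t) by lra.
    replace (2 * b * - t) with (2 * b * (0 - t)) by ring.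
    apply (curve_mean_value H (fun s => exp_coef (t - s)%R n * phi (S n) s)%C);
      [lra|].
    intros s Hs. split; [apply curve_derive_taylor_sum|apply Hb].
    rewrite Rabs_left1, (Rabs_left1 t); lra.
- replace 0 with (2 * (tau * K) * Rabs t * 0) by ring.
  apply is_lim_seq_mult'; [apply is_lim_seq_const|].
  apply (ex_series_lim_0 (fun n => (Rabs t * tau) ^ n / INR (fact n))).
  eexists. apply is_series_exp.
Qed.

End Taylor.

Lemma bernstein_monotone {E : NormedModule C_AbsRing}
    (D : unbounded_operator E) (t1 t2 : R) (f : E) :
  0 <= t1 <= t2 -> bernstein D t1 f -> bernstein D t2 f.
Proof.
intros Ht H k Hk. destruct (H k Hk) as [H1 H2]. split; [exact H1|].
eapply Rle_trans; [exact H2|].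
apply Rmult_le_compat_r; [apply norm_ge_0|]. now apply pow_incr.
Qed.

Lemma bernstein_norm_le {E : NormedModule C_AbsRing}
    (D : unbounded_operator E) (tau : R) (f : E) (k : nat) :
  bernstein D tau f -> norm (op_pow D k f) <= tau ^ k * norm f.
Proof.
intros H. destruct k as [|k]; [simpl; lra|]. apply H. lia.
Qed.

Lemma norm_le_of_operator_norm_1 {E : NormedModule C_AbsRing} (T : E -> E) :
  is_linear T -> operator_norm T = 1 -> forall f, norm (T f) <= norm f.
Proof.
intros HT Hn f.
set (P := fun r => exists f : E, norm f <= 1 /\ r = norm (T f)).
assert (U : forall h, norm h <= 1 -> norm (T h) <= 1).
{ intros h Hh. unfold operator_norm in Hn. fold P in Hn.
  destruct (Lub_Rbar_correct P) as [H1 _].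
  specialize (H1 (norm (T h)) (ex_intro _ h (conj Hh eq_refl))).
  (* The default matters: an infinite supremum is read as 0 by [real] and contradicts the operator
     norm 1. *)
  destruct (Lub_Rbar P) as [r| |]; simpl in Hn, H1; [lra|lra|contradiction]. }
destruct (Rle_lt_or_eq_dec 0 (norm f) (norm_ge_0 f)) as [Hpos|Hz].
- assert (Z : RtoC (norm f) <> 0) by (intros Z; apply RtoC_inj in Z; lra).
  assert (B := U (scal (RtoC (/ norm f)) f)).
  assert (B1 : norm (scal (RtoC (/ norm f)) f) <= 1).
  { eapply Rle_trans; [apply (norm_scal (K := C_AbsRing))|].
    change (abs (RtoC (/ norm f))) with (Cmod (RtoC (/ norm f))).
    rewrite Cmod_R, Rabs_pos_eq by (left; now apply Rinv_0_lt_compat).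
    right. field. lra. }
  specialize (B B1).
  assert (Ef : T f = scal (RtoC (norm f)) (T (scal (RtoC (/ norm f)) f))).
  { rewrite <- (linear_scal T HT), scal_assoc.
    rewrite <- (scal_one f) at 1. f_equal. f_equal.
    change (RtoC 1 = (norm f * RtoC (/ norm f))%C).
    rewrite <- RtoC_mult. f_equal. field. lra. }
  rewrite Ef. eapply Rle_trans; [apply (norm_scal (K := C_AbsRing))|].
  change (abs (RtoC (norm f))) with (Cmod (RtoC (norm f))).
  rewrite Cmod_R, Rabs_pos_eq by lra.
  apply Rle_trans with (norm f * 1); [apply Rmult_le_compat_l|]; lra.
(* A vector of norm 0 cannot be normalised; here the bound contained in [is_linear] decides. *)
- destruct (linear_norm T HT) as [C [_ HC]].
  eapply Rle_trans; [apply HC|]. rewrite <- Hz. lra.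
Qed.

Lemma locally_Cmod (l : C) (eps : R) : 0 < eps ->
  locally (T := C_NormedModule) l (fun y => Cmod (y - l)%C < eps).
Proof.
intros He.
apply (locally_le_locally_norm (V := C_NormedModule) l).
exists (mkposreal eps He). intros y Hy. exact Hy.
Qed.

(** * Orbits of a Bernstein vector and their generating function *)

Section Orbit.
Variables (E : CompleteNormedModule C_AbsRing)
  (D : unbounded_operator E) (G : R -> E -> E).
Hypothesis HG : is_isometry_C0_group G.
Hypothesis HD : is_generator D G.
Variables (tau : R) (f0 : E).
Hypothesis Htau : 0 < tau.
Hypothesis Hf : bernstein D tau f0.
Variable g : E -> C.
Hypothesis Hg : is_linear (K := C_AbsRing) (V := C_NormedModule) g.

Local Definition orbit (m : nat) (t : R) : C := g (G t (op_pow D m f0)).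

(** Since G (t + s) = G t (G s), the difference quotient at 0 stands inside the bounded functional
    [L], and the limit is g (G t (D f)) directly, without commuting D with the group. *)
Lemma curve_derive_orbit (m : nat) (t : R) :
  curve_derive (orbit m) t (orbit (S m) t).
Proof.
set (f := op_pow D m f0).
assert (Hdom : dom D f) by (apply (Hf (S m)); lia).
set (L := fun x => g (G t x)).
assert (HL : is_linear (K := C_AbsRing) (V := C_NormedModule) L)
  by (apply (is_linear_comp (G t) g); [apply HG|exact Hg]).
assert (Lim := proj2 HD f Hdom).
assert (Lim2 := filterlim_comp _ _ _ _ L _ _ _ Lim
  (linear_cont (V := C_NormedModule) L (op D f) HL)).
assert (Q : forall s, L (scal (RtoC (/ s)) (minus (G s f) f))
  = (RtoC (/ s) * (orbit m (t + s) - orbit m t))%C).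
{ intros s. rewrite (linear_scal L HL), (linear_minus L _ _ HL).
  unfold L, orbit. rewrite <- (group_add G HG). reflexivity. }
assert (Eps : forall eps, 0 < eps -> exists d : posreal, forall s, s <> 0 ->
  Rabs s < d ->
  Cmod (RtoC (/ s) * (orbit m (t + s) - orbit m t) - orbit (S m) t) < eps).
{ intros eps He.
  assert (Loc := Lim2 _ (locally_Cmod (L (op D f)) eps He)).
  destruct Loc as [d Hd]. exists d. intros s Hs Hsd.
  assert (Hb : ball 0 d s).
  { unfold ball; simpl. unfold AbsRing_ball, abs, minus, plus, opp; simpl.
    now rewrite Ropp_0, Rplus_0_r. }
  specialize (Hd s Hb Hs). rewrite Q in Hd. exact Hd. }
split; apply is_derive_Reals; intros eps He; destruct (Eps eps He) as [d Hd];
  exists d; intros h Hh Hhd; specialize (Hd h Hh Hhd);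
  (eapply Rle_lt_trans; [|exact Hd]).
- eapply Rle_trans; [|apply re_le_Cmod]. right. f_equal.
  unfold Re. simpl. field. exact Hh.
- eapply Rle_trans; [|apply im_le_Cmod]. right. f_equal.
  simpl. field. exact Hh.
Qed.

Lemma orbit_bound :
  exists K, forall m t, Cmod (orbit m t) <= tau ^ m * K.
Proof.
destruct (linear_norm g Hg) as [C [HC0 HC]].
exists (C * norm f0). intros m t. unfold orbit.
eapply Rle_trans; [apply HC|].
assert (H1 := norm_le_of_operator_norm_1 (G t) (group_bounded G HG t)
  (group_norm G HG t) (op_pow D m f0)).
assert (H2 := bernstein_norm_le D tau f0 m Hf).
rewrite <- Rmult_assoc, (Rmult_comm (tau ^ m)), Rmult_assoc.
apply Rmult_le_compat_l; [lra|exact (Rle_trans _ _ _ H1 H2)].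
Qed.

(** Scaling by tau^n turns the Bernstein estimate into boundedness of the sequence, as [egf]
    requires. This is where tau must be positive. *)
Local Definition moment (n : nat) : C := (orbit n 0 / RtoC (tau ^ n))%C.

Lemma tau_pow_C_neq_0 (n : nat) : RtoC (tau ^ n) <> 0.
Proof. intros H. apply RtoC_inj in H. revert H. apply pow_nonzero. lra. Qed.

Lemma moment_bound :
  exists K, (forall m t, Cmod (orbit m t) <= tau ^ m * K) /\
    forall n, Cmod (moment n) <= K.
Proof.
destruct orbit_bound as [K HK]. exists K. split; [exact HK|]. intros n.
unfold moment. rewrite Cmod_div, Cmod_R by apply tau_pow_C_neq_0.
assert (P : 0 < tau ^ n) by now apply pow_lt.
rewrite Rabs_pos_eq by lra. apply (Rmult_le_reg_r (tau ^ n)); [exact P|].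
unfold Rdiv. rewrite Rmult_assoc, Rinv_l, Rmult_1_r, Rmult_comm by lra. apply HK.
Qed.

Lemma exp_coef_moment (z : C) (j n : nat) :
  (RtoC (tau ^ j) * (exp_coef (tau * z) n * moment (j + n)))%C
  = (exp_coef z n * orbit (j + n) 0)%C.
Proof.
unfold moment, exp_coef. rewrite Cpow_mult_l, pow_add, RtoC_mult, <- !RtoC_pow.
assert (H1 := tau_pow_C_neq_0 j). assert (H2 := tau_pow_C_neq_0 n).
assert (H3 := fact_C_neq_0 n). Cfield.
Qed.

(** Undoes the scaling. It is used with two limits: the orbit itself at real points, and g of the
    exponential series at complex ones. *)
Lemma egf_moment (z : C) (j : nat) (l : C) :
  Cconv (Csum (fun n => exp_coef z n * orbit (j + n) 0)%C) l ->
  (RtoC (tau ^ j) * egf moment j (tau * z))%C = l.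
Proof.
intros H. destruct moment_bound as [K [_ HK]].
unfold egf.
rewrite <- (Cseries_scal _ _ _ _
  (exp_coef_dominated (tau * z) (fun n => moment (j + n)) K (fun n => HK _))
  (is_series_exp_coef_scal (tau * z) K)).
rewrite (Cseries_ext _ _ (exp_coef_moment z j)).
refine (Cconv_unique _ _ _ _ H).
apply (Cseries_correct _ (fun n => tau ^ j * (Cmod (exp_coef (tau * z) n) * K))
  (tau ^ j * (exp (Cmod (tau * z)) * K))).
- intros n. rewrite <- exp_coef_moment, Cmod_mult, Cmod_R, Rabs_pos_eq
    by (apply pow_le; lra).
  apply Rmult_le_compat_l; [apply pow_le; lra|].
  exact (exp_coef_dominated (tau * z) (fun n => moment (j + n)) K (fun n => HK _) n).
- exact (is_series_scal_l (tau ^ j) _ _ (is_series_exp_coef_scal (tau * z) K)).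
Qed.

Lemma egf_moment_real (j : nat) (t : R) :
  (RtoC (tau ^ j) * egf moment j (tau * t))%C = orbit j t.
Proof.
apply egf_moment. destruct orbit_bound as [K HK].
assert (H := taylor_series (fun n => orbit (j + n)) (tau ^ j * K) tau).
cbv beta in H. rewrite Nat.add_0_r in H. apply H.
- intros m s. rewrite Nat.add_succ_r. apply curve_derive_orbit.
- intros m s. eapply Rle_trans; [apply HK|]. right. rewrite pow_add. ring.
Qed.

(** The bound on the orbits is uniform in time because the group is isometric. Hence one constant
    bounds every derivative on the whole real axis, as [egf_strip_bound] demands. *)
Lemma egf_moment_real_bound (K : R) (j : nat) (x : R) :
  (forall m t, Cmod (orbit m t) <= tau ^ m * K) ->
  Cmod (egf moment j x) <= K.
Proof.
intros HK. assert (H := egf_moment_real j (x / tau)).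
replace (tau * (x / tau)%R)%C with (RtoC x) in H.
2:{ rewrite <- RtoC_mult. f_equal. field. lra. }
assert (P : 0 < tau ^ j) by now apply pow_lt.
apply (Rmult_le_reg_l (tau ^ j)); [exact P|].
eapply Rle_trans; [|apply (HK j (x / tau))].
rewrite <- H, Cmod_mult, Cmod_R, Rabs_pos_eq; lra.
Qed.

Lemma egf_moment_exp_op (z : C) :
  egf moment 0 (tau * z) = g (exp_op D z f0).
Proof.
rewrite <- (egf_moment z 0 (g (exp_op D z f0))).
- simpl. ring.
- assert (H := exp_op_correct E D tau f0 z Hf).
  assert (H2 := filterlim_comp _ _ _ _ g _ _ _ H
    (linear_cont (V := C_NormedModule) g (exp_op D z f0) Hg)).
  intros eps He.
  destruct (H2 _ (locally_Cmod (g (exp_op D z f0)) eps He)) as [N HN].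
  exists N. intros n Hn. specialize (HN n Hn).
  replace (Csum (fun n => exp_coef z n * orbit (0 + n) 0)%C n)
    with (g (sum_n (exp_term D z f0) n)); [exact HN|].
  assert (T : forall k, g (exp_term D z f0 k) = (exp_coef z k * orbit (0 + k) 0)%C).
  { intros k. unfold exp_term. rewrite (linear_scal g Hg).
    unfold orbit. rewrite (group_zero G HG). reflexivity. }
  clear HN Hn. induction n as [|n IH].
  + rewrite sum_O, Csum_O. apply T.
  + rewrite sum_Sn, Csum_S, (linear_plus g Hg), IH, T. reflexivity.
Qed.

End Orbit.

(** * From bounded sets to compact sets, and the sampling formula *)

Lemma compact_set_bounded (K : C -> Prop) : compact_set K ->
  exists B, forall z, K z -> Cmod z <= B.
Proof.
intros HK.
destruct (HK (fun U => exists n : nat, U = (fun z => Cmod z < INR n)))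
  as [l [Hl Hcov]].
- intros U [n ->] z Hz.
  (* Half the gap, because balls of C are squares and the modulus is estimated by the sum of the two
     coordinates. *)
  assert (He : 0 < (INR n - Cmod z) / 2) by lra.
  exists (mkposreal _ He). intros y [H1 H2].
  unfold ball in H1, H2; simpl in H1, H2.
  unfold AbsRing_ball, abs, minus, plus, opp in H1, H2; simpl in H1, H2.
  assert (H3 := Cmod_le_Rabs (y - z)%C). simpl in H3.
  assert (H4 := Cmod_triangle_rev y z). lra.
- intros z _. destruct (nfloor_ex (Cmod z) (Cmod_ge_0 z)) as [n Hn].
  exists (fun z => Cmod z < INR (S n)). split; [now exists (S n)|].
  rewrite S_INR. lra.
- assert (Hb : exists B, forall U z, In U l -> U z -> Cmod z <= B).
  { clear Hcov. induction l as [|U l IH].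
    - exists 0. intros U z [].
    - destruct IH as [B HB]; [intros V HV; apply Hl; now right|].
      destruct (Hl U (or_introl eq_refl)) as [n Hn].
      exists (Rmax B (INR n)). intros V z [<-|HV] Hz.
      + eapply Rle_trans; [|apply Rmax_r]. rewrite Hn in Hz. lra.
      + eapply Rle_trans; [|apply Rmax_l]. now apply (HB V). }
  destruct Hb as [B HB]. exists B. intros z Hz.
  destruct (Hcov z Hz) as [U [HU HUz]]. now apply (HB U).
Qed.

Theorem theorem2p12 :
  forall (E : CompleteNormedModule C_AbsRing)
         (D : unbounded_operator E) (G : R -> E -> E),
    is_isometry_C0_group G ->
    is_generator D G ->
    forall (tau sigma : R), 0 <= tau < sigma ->
    forall f0 : E, bernstein D tau f0 ->
    forall g : E -> C, is_linear (K := C_AbsRing) (V := C_NormedModule) g ->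
      let sample (z : C) (k : Z) : C :=
        (g (G (IZR k * PI / sigma)%R f0)
           * sinc (RtoC (sigma / PI) * z - RtoC (IZR k)))%C in
      (forall z : C, is_bilateral_series (sample z) (g (exp_op D z f0))) /\
      (forall K : C -> Prop, compact_set K ->
         converges_uniformly_on K
           (fun N z => symmetric_sum (sample z) N)
           (fun z => g (exp_op D z f0))).
Proof.
intros E D G HG HD tau0 sigma Hts f0 Hf0 g Hg sample.
(* The midpoint is positive even if [tau0] is 0, so the moments are defined, and it is still below
   [sigma], so that rho < pi. *)
set (tau := (tau0 + sigma) / 2).
assert (Htau : 0 < tau < sigma) by (unfold tau; lra).
assert (Hf : bernstein D tau f0)
  by (apply (bernstein_monotone D tau0); [unfold tau; lra|exact Hf0]).
assert (HPI := PI_RGT_0).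
set (rho := tau * PI / sigma).
assert (Hrho : 0 <= rho < PI).
{ unfold rho. split.
  - apply Rdiv_le_0_compat; [apply Rmult_le_pos|]; lra.
  - apply (Rmult_lt_reg_r sigma); [lra|].
    unfold Rdiv. rewrite Rmult_assoc, Rinv_l by lra. nra. }
set (a := moment E D G tau f0 g).
destruct (moment_bound E D G HG tau f0 (proj1 Htau) Hf g Hg) as [M [HM1 HM2]].
assert (Hreal := fun j x => egf_moment_real_bound E D G HG HD tau f0
  (proj1 Htau) Hf g Hg M j x HM1).
fold a in HM2, Hreal.
(* Uniformity on discs yields both claims: pointwise convergence with radius |z|, and compact sets
   through their boundedness. *)
assert (Unif : forall B eps, 0 < eps -> exists N0 : nat, forall N, (N0 <= N)%nat ->
  forall z, Cmod z <= B ->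
    Cmod (symmetric_sum (sample z) N - g (exp_op D z f0))%C < eps).
{ intros B eps He.
  set (B' := sigma / PI * B).
  destruct (sampling_error_uniform a M rho B' HM2 Hreal Hrho) as [K HK].
  assert (HKp := Rabs_pos K).
  (* Beyond this threshold N - B' exceeds (|K| + 1) / eps, so K / (N - B') < eps strictly; the added
     1 covers K = 0. The maximum with 0 is there for [nfloor_ex]. *)
  destruct (nfloor_ex (Rmax 0 (B' + (Rabs K + 1) / eps)) (Rmax_l _ _)) as [n Hn].
  exists (S n). intros N HN z Hz.
  apply le_INR in HN. rewrite S_INR in HN.
  assert (HB1 := Rmax_r 0 (B' + (Rabs K + 1) / eps)).
  assert (Hq : 0 < (Rabs K + 1) / eps) by (apply Rdiv_lt_0_compat; lra).
  set (u := (RtoC (sigma / PI) * z)%C).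
  assert (Hs : 0 < sigma / PI) by (apply Rdiv_lt_0_compat; lra).
  assert (Hu : Cmod u <= B').
  { unfold u, B'. rewrite Cmod_mult, Cmod_R, Rabs_pos_eq by lra.
    apply Rmult_le_compat_l; lra. }
  specialize (HK N u Hu ltac:(lra)).
  replace (symmetric_sum (sample z) N) with
    (Csum (fun j => egf a 0 (rho * node N j) * sinc (u - node N j))%C (2 * N)).
  2:{ apply Csum_ext. intros j _. unfold sample. rewrite node_IZR. fold u. f_equal.
    rewrite <- node_IZR.
    set (x := IZR (Z.of_nat j - Z.of_nat N)).
    change (g (G (x * PI / sigma) f0)) with (orbit E D G f0 g 0 (x * PI / sigma)).
    rewrite <- (egf_moment_real E D G HG HD tau f0 (proj1 Htau) Hf g Hg).
    fold a. simpl pow. rewrite Cmult_1_l. f_equal.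
    (* The scaling was chosen for this match: rho times the node is tau times the sampling time k pi
       / sigma. *)
    rewrite <- !RtoC_mult. f_equal. unfold rho. field. lra. }
  replace (g (exp_op D z f0)) with (egf a 0 (rho * u)).
  2:{ rewrite <- (egf_moment_exp_op E D G HG tau f0 (proj1 Htau) Hf g Hg).
    f_equal. unfold u, rho. rewrite Cmult_assoc, <- RtoC_mult. f_equal. f_equal.
    field. lra. }
  eapply Rle_lt_trans; [exact HK|].
  assert (Hd : 0 < INR N - B') by lra.
  apply (Rmult_lt_reg_r (INR N - B')); [exact Hd|].
  unfold Rdiv. rewrite Rmult_assoc, Rinv_l, Rmult_1_r by lra.
  assert (H1 : Rabs K + 1 <= eps * (INR N - B')).
  { replace (Rabs K + 1) with (eps * ((Rabs K + 1) / eps)) by (field; lra).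
    apply Rmult_le_compat_l; lra. }
  assert (H2 := Rle_abs K). lra. }
split.
- intros z. unfold is_bilateral_series. apply filterlim_locally. intros eps.
  destruct (Unif (Cmod z) eps (cond_pos eps)) as [N0 HN0].
  exists N0. intros n Hn.
  apply (C_NormedModule_mixin_compat1 (g (exp_op D z f0))).
  apply (HN0 n Hn). lra.
- intros K HK eps He.
  destruct (compact_set_bounded K HK) as [B HB].
  destruct (Unif B eps He) as [N0 HN0].
  exists N0. intros N HN z Hz. apply HN0; [exact HN|]. now apply HB.
Qed.
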